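(* Let $n\geq 1$, let $H$ be any graph, and let $S=K[V(P_n\odot H)]$. Then (a) $\operatorname{depth}(S/I(P_n\odot H))=\lceil\frac{n}{2}\rceil+\lceil\frac{n-1}{2}\rceil\big(\operatorname{depth}(K[V(H)]/I(H))+|i(H)|\big)$; (b) $\operatorname{sdepth}(S/I(P_n\odot H))\geq\lceil\frac{n}{2}\rceil+\lceil\frac{n-1}{2}\rceil\big(\operatorname{sdepth}(K[V(H)]/I(H))+|i(H)|\big)$. In particular, if $H$ is a null graph, then $\operatorname{sdepth}(S/I(P_n\odot H))=\lceil\frac{n}{2}\rceil+\lceil\frac{n-1}{2}\rceil|V(H)|$.
   Context: $K$ is a field. All graphs are finite, simple, have nonempty vertex set, and may have isolated vertices. Vertices of a graph $G$ are identified with the variables of the standard graded polynomial ring $K[V(G)]$. A null graph is a graph with no edges. $i(H)$ denotes the set of isolated vertices of $H$. Edge ideal convention: $I(G)\subset K[V(G)]$ is the ideal generated by all products $x_ix_j$ with $\{x_i,x_j\}\in E(G)$ together with all variables $x_k$ with $x_k$ an isolated vertex of $G$. Thus $K[V(H)]/I(H)\cong K[V(H')]/I(H')$, where $H'$ is the induced subgraph of $H$ on the non-isolated vertices, and if $H$ is null then $K[V(H)]/I(H)\cong K$ with depth and Stanley depth $0$. The corona product $X\odot H$ is the graph obtained from one copy of $X$ and $|V(X)|$ disjoint copies of $H$, namely $H_1,\dots,H_{|V(X)|}$, by joining the $i$-th vertex of $X$ to every vertex of $H_i$. It has no isolated vertices, so $I(X\odot H)$ is the usual edge ideal. $P_n$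 is the path on $n$ vertices ($P_1$ is a single vertex). $\operatorname{depth}$ is taken with respect to the graded maximal ideal. For a finitely generated $\mathbb{Z}^r$-graded module $A$ over a polynomial ring $R$ in $r$ variables over $K$, a Stanley decomposition is a finite direct sum of $K$-vector spaces $A=\bigoplus_{i} a_iK[X_i]$ with $a_i\in A$ homogeneous, $X_i$ a subset of the variables, and $a_iK[X_i]$ (the $K$-span of all $a_it$, $t$ a monomial in $K[X_i]$) a free $K[X_i]$-module; its Stanley depth is $\min_i|X_i|$, and $\operatorname{sdepth}(A)$ is the maximum over all Stanley decompositions of $A$. *)

(* Defs.v *)
From Stdlib Require Import ClassicalEpsilon.
From HB Require Import structures.
From mathcomp Require Import all_boot all_order all_algebra.
From mathcomp Require Import mpoly.

Set Implicit Arguments.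
Unset Strict Implicit.
Unset Printing Implicit Defensive.

Import GRing.Theory.
Local Open Scope ring_scope.

Definition is_nat_max (P : nat -> Prop) (d : nat) : Prop :=
  P d /\ forall k : nat, P k -> (k <= d)%N.

(* An unspecified natural number when [P] is empty or unbounded. *)
Definition nat_max (P : nat -> Prop) : nat := epsilon (inhabits 0%N) (is_nat_max P).

Lemma nat_max_eq (P : nat -> Prop) (d : nat) : is_nat_max P d -> nat_max P = d.
Proof.
move=> Pd; have [Pe le_e] : is_nat_max P (nat_max P).
  by apply: epsilon_spec; exists d.
by case: Pd => Pd le_d; apply/eqP; rewrite eqn_leq le_d //= le_e.
Qed.

Record sgraph := SGraph {
  vertex :> finType;
  adj : rel vertex;
  adj_sym : ssrbool.symmetric adj;
  adj_irr : irreflexive adj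
}.

Definition isolated (G : sgraph) : {set G} := [set x | [forall y, ~~ adj x y]].

Definition null_graph (G : sgraph) : Prop := forall x y : G, ~~ adj x y.

Section PathGraph.
Variable n : nat.

Definition path_adj (i j : 'I_n) : bool :=
  (i.+1 == j :> nat) || (j.+1 == i :> nat).

Lemma path_adj_sym : ssrbool.symmetric path_adj.
Proof. by move=> i j; rewrite /path_adj orbC. Qed.

Lemma path_adj_irr : irreflexive path_adj.
Proof. by move=> i; rewrite /path_adj orbb gtn_eqF. Qed.

Definition path_graph : sgraph := SGraph path_adj_sym path_adj_irr.

End PathGraph.

Section Corona.
Variables X H : sgraph.

(* [inl x] is the vertex [x] of [X]; [inr (x, h)] is the vertex [h] of the copy
   of [H] attached to [x]. *)
Definition corona_adj (u v : X + X * H) : bool :=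
  match u, v with
  | inl x, inl y => adj x y
  | inl x, inr (y, _) => x == y
  | inr (x, _), inl y => x == y
  | inr (x, h), inr (y, k) => (x == y) && adj h k
  end.

Lemma corona_adj_sym : ssrbool.symmetric corona_adj.
Proof.
case=> [x|[x h]] [y|[y k]] //=; first exact: adj_sym.
by rewrite eq_sym adj_sym.
Qed.

Lemma corona_adj_irr : irreflexive corona_adj.
Proof. by case=> [x|[x h]] /=; rewrite adj_irr ?andbF. Qed.

Definition corona : sgraph := SGraph corona_adj_sym corona_adj_irr.

End Corona.

Definition ideal_gen (R : comNzRingType) (gens : R -> Prop) (f : R) : Prop :=
  exists (k : nat) (c g : 'I_k -> R),
    (forall i, gens (g i)) /\ f = \sum_(i < k) c i * g i.

Section Depth.
Variables (K : fieldType) (n : nat).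
Local Notation S := {mpoly K[n]}.

Definition max_ideal : S -> Prop := ideal_gen (fun f => exists i : 'I_n, f = 'X_i).

(* The ideal [I + (s)] of [S], that is, the submodule [(s)(S/I)] of [S/I]. *)
Definition ideal_add (I : S -> Prop) (s : seq S) : S -> Prop :=
  ideal_gen (fun f => I f \/ f \in s).

(* [s] is an [S/I]-regular sequence of elements of the graded maximal ideal. *)
Definition regular_seq (I : S -> Prop) (s : seq S) : Prop :=
  [/\ forall f, f \in s -> max_ideal f,
      forall i : nat, (i < size s)%N -> forall g : S,
        ideal_add I (take i s) (s`_i * g) -> ideal_add I (take i s) g
    & ~ ideal_add I s 1].

(* depth of the module [S/I] *)
Definition depth (I : S -> Prop) : nat :=
  nat_max (fun r => exists s : seq S, regular_seq I s /\ size s = r).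

Definition poly_in (X : {set 'I_n}) (p : S) : Prop :=
  forall m : 'X_{1..n}, m \in msupp p -> forall i : 'I_n, i \notin X -> m i = 0%N.

(* A Stanley decomposition [S/I = \bigoplus_i a_i K[X_i]] for a monomial ideal
   [I]. Elements of [S/I] are given by representatives in [S]; as [I] is
   monomial, the homogeneous elements of the Z^n-graded module [S/I] are exactly
   the classes of the scalar multiples of monomials. The second condition says
   that [a_i] has zero annihilator in [K[X_i]], i.e. [a_i K[X_i]] is free on [a_i]. *)
Definition stanley_decomposition (I : S -> Prop)
    (k : nat) (a : 'I_k -> S) (X : 'I_k -> {set 'I_n}) : Prop :=
  [/\ forall i, exists (c : K) (m : 'X_{1..n}), a i = c *: 'X_[m],
      forall i p, poly_in (X i) p -> I (a i * p) -> p = 0,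
      forall f : S, exists p : 'I_k -> S,
        (forall i, poly_in (X i) (p i)) /\ I (f - \sum_(i < k) a i * p i)
    & forall p : 'I_k -> S, (forall i, poly_in (X i) (p i)) ->
        I (\sum_(i < k) a i * p i) -> forall i, I (a i * p i)].

(* Stanley depth of the module [S/I]. Since [#|X i| <= n], the bound [n] in the
   minimum plays no role unless the decomposition is empty, i.e. [S/I = 0]. *)
Definition sdepth (I : S -> Prop) : nat :=
  nat_max (fun r => exists (k : nat) (a : 'I_k -> S) (X : 'I_k -> {set 'I_n}),
    stanley_decomposition I a X /\ \big[minn/n]_(i < k) #|X i| = r).

End Depth.

Section EdgeIdeal.
Variables (K : fieldType) (G : sgraph).

Definition vertex_var (x : G) : {mpoly K[#|G|]} := 'X_(enum_rank x).

(* Isolated vertices contribute their variable as a generator. *)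
Definition edge_ideal : {mpoly K[#|G|]} -> Prop :=
  ideal_gen (fun f =>
    (exists x y : G, adj x y /\ f = vertex_var x * vertex_var y) \/
    (exists x : G, x \in isolated G /\ f = vertex_var x)).

End EdgeIdeal.

Arguments edge_ideal : clear implicits.

(* Main.v *)
Require Import Defs.
From Stdlib Require Import Classical ClassicalEpsilon FunctionalExtensionality PropExtensionality.
From mathcomp Require Import all_boot all_order all_algebra.
From mathcomp Require Import ring zify.
From mathcomp Require Import ssrcomplements mpoly.

(** Write [t] for the depth of the edge ring of [H] on its non-isolated vertices plus the
 number of isolated ones, which become free variables in the corona. The formula comes
 from the last vertex [v] of the path. In [S/(I : v)] the vertex [v] is a free variable
 and its neighbours vanish, which splits off the copy of [H] at the previous position; in
 [S/(I + v)] the copy of [H] at [v] splits off. As depths add up over disjoint blocks of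
 variables, and [t > 0], the depth of [S/(I + v)] is at least that of [S/(I : v)], and then
 [S/I] has the depth of [S/(I : v)] (has_depth_colon). This gives
 [d (n + 2) = d n + t + 1]; see initial_depth.

 Depth is the maximal length of a regular sequence of arbitrary elements without constant
 term, so these rules are proved by elementary ideal arithmetic. A regular sequence has
 maximal length exactly when the quotient by it has a nonzero socle. That this length is
 the same for all maximal regular sequences (socle_invariant) follows by exchanging their
 last terms for a common regular element, which prime avoidance provides in a Noetherian
 ring (common_regular, mpoly_noetherian). The same common elements prove the rule for [v].
 For a tensor product over the field, the quotient by an ideal in one block of variables is
 free over the polynomials in the other variables (block_projection); hence maximal regular
 sequences of the factors concatenate to a maximal one (has_depth_tensor).

 For a monomial ideal a Stanley decomposition amounts to a partition of the remaining
 monomials into cones (cone_partition_decomposition, stanley_cone_partition). Separating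
 the monomials divisible by [v] from the others, and multiplying cones in disjoint blocks,
 gives the same rules as lower bounds (graph_sdepth_vertex, graph_sdepth_disjoint), so one
 induction serves both invariants. For null [H] the bound is attained: a cone containing a
 high power of the product over a maximal independent set has at most that many free
 variables (sdepth_ge_facet), and the even path vertices together with the odd copies of
 [H] form such a set. *)

Set Implicit Arguments.
Unset Strict Implicit.
Unset Printing Implicit Defensive.

Import Order.TTheory GRing.Theory.
Local Open Scope ring_scope.

(** * Ideals and regular sequences *)

Lemma pred_ext T (P Q : T -> Prop) : (forall x, P x <-> Q x) -> P = Q.
Proof.
move=> PQ; apply: functional_extensionality => x.
exact: propositional_extensionality.
Qed.

Section Ideals.
Variable R : comNzRingType.
Implicit Types (I J L E : R -> Prop) (a c e f g h u v x : R) (s : seq R).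

Definition ideal J : Prop :=
  [/\ J 0, forall f g, J f -> J g -> J (f + g) & forall c f, J f -> J (c * f)].

Section IdealTheory.
Variables (J : R -> Prop) (idJ : ideal J).

Lemma ideal_0 : J 0. Proof. by case: idJ. Qed.
Lemma ideal_D f g : J f -> J g -> J (f + g). Proof. by case: idJ => _ + _; apply. Qed.
Lemma ideal_Ml c f : J f -> J (c * f). Proof. by case: idJ => _ _; apply. Qed.
Lemma ideal_Mr c f : J f -> J (f * c). Proof. by rewrite mulrC; apply: ideal_Ml. Qed.
Lemma ideal_N f : J f -> J (- f). Proof. by rewrite -mulN1r; apply: ideal_Ml. Qed.
Lemma ideal_B f g : J f -> J g -> J (f - g).
Proof. by move=> Jf Jg; apply: ideal_D => //; apply: ideal_N. Qed.

Lemma ideal_congr f g : J (f - g) -> J g -> J f.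
Proof. by move=> Jfg Jg; rewrite -(subrK g f); apply: ideal_D. Qed.

Lemma ideal_sum (T : Type) (r : seq T) (P : pred T) (F : T -> R) :
  (forall i, P i -> J (F i)) -> J (\sum_(i <- r | P i) F i).
Proof. by move=> JF; apply: (big_ind J) => //; [apply: ideal_0 | apply: ideal_D]. Qed.

End IdealTheory.

Definition addI J x : R -> Prop := fun f => exists a, J (f - a * x).
Definition sumI I J : R -> Prop := fun f => exists2 a, I a & J (f - a).
Definition colon J x : R -> Prop := fun f => J (f * x).
Definition adds J s : R -> Prop := foldl addI J s.

Lemma addI_ideal J x : ideal J -> ideal (addI J x).
Proof.
move=> idJ; split; first by exists 0; rewrite mul0r subr0; apply: ideal_0.
  move=> f g [a Ja] [b Jb]; exists (a + b).
  by rewrite (_ : _ - _ = (f - a * x) + (g - b * x)); [apply: ideal_D | ring].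
move=> c f [a Ja]; exists (c * a).
by rewrite (_ : _ - _ = c * (f - a * x)); [apply: ideal_Ml | ring].
Qed.

Lemma colon_ideal J x : ideal J -> ideal (colon J x).
Proof.
move=> idJ; split; rewrite /colon; first by rewrite mul0r; apply: (ideal_0 idJ).
  by move=> f g Jf Jg; rewrite mulrDl; apply: ideal_D.
by move=> c f Jf; rewrite -mulrA; apply: ideal_Ml.
Qed.

Lemma sumI_ideal I J : ideal I -> ideal J -> ideal (sumI I J).
Proof.
move=> idI idJ; split; 
  first by exists 0; rewrite ?subr0; [exact: (ideal_0 idI) | exact: (ideal_0 idJ)].
  move=> f g [a Ia Ja] [b Ib Jb]; exists (a + b); first exact: (ideal_D idI).
  by rewrite (_ : _ - _ = (f - a) + (g - b)); [apply: (ideal_D idJ) | ring].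
move=> c f [a Ia Ja]; exists (c * a); first exact: (ideal_Ml idI).
by rewrite -mulrBr; apply: (ideal_Ml idJ).
Qed.

Lemma adds_ideal J s : ideal J -> ideal (adds J s).
Proof. by elim: s J => //= x s IHs J idJ; apply: IHs; apply: addI_ideal. Qed.

Lemma sub_addI J x f : J f -> addI J x f.
Proof. by move=> Jf; exists 0; rewrite mul0r subr0. Qed.

Lemma mem_addI J x : ideal J -> addI J x x.
Proof. by move=> idJ; exists 1; rewrite mul1r subrr; apply: (ideal_0 idJ). Qed.

Lemma addI_sub J L x : ideal L -> (forall f, J f -> L f) -> L x ->
  forall f, addI J x f -> L f.
Proof.
move=> idL JL Lx f [a /JL Lf]; rewrite -(subrK (a * x) f).
by apply: (ideal_D idL) => //; apply: (ideal_Ml idL).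
Qed.

Lemma addIC J x y : ideal J -> addI (addI J x) y = addI (addI J y) x.
Proof.
move=> idJ; apply: pred_ext => f; split=> -[a [b Jab]]; exists b; exists a.
  by rewrite addrAC.
by rewrite addrAC.
Qed.

Lemma adds_addI J x s : ideal J -> adds (addI J x) s = addI (adds J s) x.
Proof.
elim: s J => //= y s IHs J idJ.
by rewrite addIC // IHs //; apply: addI_ideal.
Qed.

Lemma sumI_sub I J L : ideal L -> (forall f, I f -> L f) -> (forall f, J f -> L f) ->
  forall f, sumI I J f -> L f.
Proof.
by move=> idL IL JL f [a /IL La /JL Lb]; rewrite -(subrK a f); apply: (ideal_D idL).
Qed.

Lemma sumIC I J : sumI I J = sumI J I.
Proof.
have sub I' J' f : sumI I' J' f -> sumI J' I' f.
  by case=> a Ia Ja; exists (f - a); rewrite // subKr.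
by apply: pred_ext => f; split; apply: sub.
Qed.

Lemma sumI_addI I J x : sumI (addI I x) J = addI (sumI I J) x.
Proof.
apply: pred_ext => f; split.
  case=> a [b Iab] Jfa; exists b; exists (a - b * x) => //.
  by rewrite (_ : _ - _ = f - a) //; ring.
case=> b [a Ia Jf]; exists (a + b * x); first by exists b; rewrite addrK.
by rewrite (_ : _ - _ = f - b * x - a) //; ring.
Qed.

Lemma sumI_addI_r I J x : sumI I (addI J x) = addI (sumI I J) x.
Proof. by rewrite sumIC sumI_addI sumIC. Qed.

Definition regular J f : Prop := forall g, J (f * g) -> J g.

Fixpoint regseq J s : Prop :=
  if s is f :: s' then regular J f /\ regseq (addI J f) s' else True.

Definition socle_nz E J : Prop := exists2 u, ~ J u & forall e, E e -> J (e * u).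

Lemma regular_soc E J e : E e -> regular J e -> ~ socle_nz E J.
Proof. by move=> Ee reg [u nJu Eu]; apply/nJu/reg/Eu. Qed.

Lemma regseq_cat J s1 s2 :
  regseq J (s1 ++ s2) <-> regseq J s1 /\ regseq (adds J s1) s2.
Proof. by elim: s1 J => [|f s1 IHs] J /=; [tauto | rewrite IHs; tauto]. Qed.

Lemma adds_cat J s1 s2 : adds J (s1 ++ s2) = adds (adds J s1) s2.
Proof. exact: foldl_cat. Qed.

(** The relation [g u = f v] modulo [J] turns a socle element [u] of [R/(J+f)] into a
 socle element [v] of [R/(J+g)]. *)
Lemma socle_exchange E J f g : ideal J -> E f -> E g -> regular J f -> regular J g ->
  socle_nz E (addI J f) -> socle_nz E (addI J g).
Proof.
move=> idJ Ef Eg regf regg [u nu Eu].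
have [v Jv] := Eu g Eg; exists v.
  case=> w Jw; apply: nu; exists w; apply: regg.
  rewrite (_ : _ * _ = (g * u - v * f) + f * (v - w * g)); last by ring.
  by apply: (ideal_D idJ) => //; apply: (ideal_Ml idJ).
move=> e Ee; have [w Jw] := Eu e Ee; exists w; apply: regf.
rewrite (_ : _ * _ = - (e * (g * u - v * f)) + g * (e * u - w * f)); last by ring.
by apply: (ideal_D idJ) => //; [apply: ideal_N | ]; rewrite //; apply: (ideal_Ml idJ).
Qed.

(** An element that is regular modulo each of these ideals can be moved to the front of
 [s], see [regseq_move]. *)
Fixpoint stages J s : seq (R -> Prop) :=
  J :: if s is f :: s' then stages (addI J f) s' else [::].

Lemma mem_stages0 J s : List.In J (stages J s).
Proof. by case: s => [|f s]; left. Qed.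

Lemma mem_stages_adds J s : List.In (adds J s) (stages J s).
Proof. by elim: s J => [|f s IHs] J /=; [left | right; apply: IHs]. Qed.

Lemma regseq_rcons J s f : regseq J (rcons s f) <-> regseq J s /\ regular (adds J s) f.
Proof. by rewrite -cats1 regseq_cat /=; tauto. Qed.

Lemma adds_rcons J s f : adds J (rcons s f) = addI (adds J s) f.
Proof. by rewrite -cats1 adds_cat. Qed.

Lemma stages_socle E J s f : ideal J -> (forall e, e \in rcons s f -> E e) ->
  regseq J (rcons s f) ->
  forall L, List.In L (stages J s) -> ideal L /\ ~ socle_nz E L.
Proof.
elim: s J => [|g s IHs] J idJ Es [regh regs] L /=.
  by case=> // <-; split=> //; apply: regular_soc regh; apply: Es; rewrite mem_head.
case=> [<- | ]; first by split=> //; apply: regular_soc regh; apply: Es; rewrite mem_head.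
apply: IHs => //; first exact: addI_ideal.
by move=> e se; apply: Es; rewrite rcons_cons in_cons se orbT.
Qed.

(** In the non-local, non-graded setting regular sequences cannot be permuted freely;
 moving [h] to the front is legitimate because it is regular at each stage. *)
Lemma regseq_move J s h : ideal J -> regseq J s ->
  (forall L, List.In L (stages J s) -> regular L h) -> regseq (addI J h) s.
Proof.
elim: s J => //= f s IHs J idJ [regf regs] regh.
have regfh L : List.In L (stages (addI J f) s) -> regular L h.
  by move=> sL; apply: regh; right.
split; last by rewrite addIC //; apply: IHs => //; apply: addI_ideal.
move=> g [b Jb].
have [c Jc]: addI J f b.
  apply: (regfh _ (mem_stages0 _ _)); exists g.
  by rewrite (_ : h * b - g * f = - (f * g - b * h)); [apply: (ideal_N idJ) | ring].
exists c; apply: regf.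
rewrite (_ : _ * _ = (f * g - b * h) + h * (b - c * f)); last by ring.
by apply: (ideal_D idJ) => //; apply: (ideal_Ml idJ).
Qed.

Definition prime_ideal P : Prop :=
  [/\ ideal P, ~ P 1 & forall f g, P (f * g) -> P f \/ P g].

(** Regular sequences are taken inside such an [E], below the polynomials without constant
 term in a block of variables, so that they stay in that block. *)
Definition subrng E : Prop :=
  [/\ E 0, forall f g, E f -> E g -> E (f + g) & forall f g, E f -> E g -> E (f * g)].

(** By induction on the list: if [e] avoids all of [ps] but lies in [P], then [e + y] avoids
 every prime, where [y] is a product, outside [P], of elements of [E] taken from each
 member of [ps]. *)
Lemma prime_avoidance E (ps : seq (R -> Prop)) :
  subrng E ->
  (forall P, List.In P ps -> prime_ideal P /\ exists2 e, E e & ~ P e) ->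
  exists2 e, E e & forall P, List.In P ps -> ~ P e.
Proof.
case=> E0 ED EM; have [k] := ubnP (size ps); elim: k ps => // k IHk [|P ps] /= leps Pps.
  by exists 0.
have [[primeP [e0 Ee0 Pe0]] primeps] : (prime_ideal P /\ exists2 e, E e & ~ P e) /\
   forall Q, List.In Q ps -> prime_ideal Q /\ exists2 e, E e & ~ Q e.
  by split; [apply: Pps; left | move=> Q psQ; apply: Pps; right].
have [[Q psQ QP] | noQ] :=
    classic (exists2 Q, List.In Q ps & forall e, E e -> Q e -> P e).
  (* Avoiding [P] already avoids [Q], which can be dropped from the list. *)
  have [l1 [l2 def_ps]] := List.in_split _ _ psQ.
  have ltk: (size (P :: l1 ++ l2) < k)%N.
    by move: leps; rewrite def_ps /= !size_cat /= addnS.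
  have primel Q' : List.In Q' (P :: l1 ++ l2) ->
      prime_ideal Q' /\ exists2 e, E e & ~ Q' e.
    case=> [<- | Q'l]; first by split=> //; exists e0.
    apply: primeps; rewrite def_ps; apply: List.in_or_app.
    by case: (List.in_app_or _ _ _ Q'l); [left | right; right].
  have [e Ee ePs] := IHk _ ltk primel.
  exists e => // Q' [<- | ]; first by apply: ePs; left.
  rewrite def_ps => /(List.in_app_or _ _ _) [Q'l | [<- | Q'l]].
  - by apply: ePs; right; apply: List.in_or_app; left.
  - by move/(QP e Ee); apply: ePs; left.
  - by apply: ePs; right; apply: List.in_or_app; right.
have [e Ee ePs] := IHk ps leps primeps.
have [Pe | ] := classic (P e); last first.
  by move=> nPe; exists e => // Q [<- // | /ePs].
have {noQ} [y Py yPs]: exists2 y, ~ P y & (E y \/ ps = [::]) /\ forall Q, List.In Q ps -> Q y.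
  elim: ps primeps noQ {Pps leps ePs} => [_ _ | Q ps IHps primeps noQ].
    by exists 1; [case: primeP | split; [right|]].
  have [||y Py [Ey yPs]] := IHps.
  - by move=> Q' psQ'; apply: primeps; right.
  - by case=> Q' psQ' Q'P; apply: noQ; exists Q' => //; right.
  have [z [Ez Qz Pz]]: exists z, [/\ E z, Q z & ~ P z].
    apply: NNPP => noz; apply: noQ; exists Q; first by left.
    by move=> z Ez Qz; apply: NNPP => Pz; apply: noz; exists z.
  have idQ: ideal Q by have [[]] := primeps Q (or_introl erefl).
  have idps Q' : List.In Q' ps -> ideal Q'.
    by move=> psQ'; have [[]] := primeps Q' (or_intror psQ').
  case: Ey => [Ey | ps0]; last first.
    by exists z => //; split; [left | rewrite ps0 => Q' [<- | []]].
  exists (y * z); first by case: primeP => _ _ Pm /Pm [].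
  split; first by left; apply: EM.
  move=> Q' [<- | psQ']; first exact: ideal_Ml.
  by apply: ideal_Mr; [apply: idps | apply: yPs].
case: yPs => [[Ey | ps0] yPs]; last first.
  by exists e0 => // Q [<- | ] //; rewrite ps0.
exists (e + y); first exact: ED.
move=> Q [<- | psQ] Qey.
  by apply: Py; rewrite -(addKr e y) addrC; apply: ideal_B; case: primeP.
have [[idQ _ _] _] := primeps Q psQ.
by apply: (ePs Q psQ); rewrite -(addrK y e); apply: ideal_B => //; apply: yPs.
Qed.

(** * Depth in a Noetherian ring *)

Definition strict_sub J L : Prop :=
  (forall f, J f -> L f) /\ exists2 f, L f & ~ J f.

Lemma strict_addI J x : ~ J x -> ideal J -> strict_sub J (addI J x).
Proof.
by move=> nJx idJ; split=> [f|]; [apply: sub_addI | exists x => //; apply: mem_addI].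
Qed.

Section Noetherian.
Hypothesis noethR : forall Q : (R -> Prop) -> Prop,
  (forall J, ideal J -> (forall L, ideal L -> strict_sub J L -> Q L) -> Q J) ->
  forall J, ideal J -> Q J.


(** The ideals [J : v] for such [v] are the maximal associated primes of [R/J]. *)
Definition maximal_ann J v : Prop :=
  ~ J v /\ forall w, ~ J w -> (forall g, J (g * v) -> J (g * w)) ->
    forall g, J (g * w) -> J (g * v).

Lemma maximal_ann_prime J v : ideal J -> maximal_ann J v -> prime_ideal (colon J v).
Proof.
move=> idJ [Jv maxv]; split; [exact: colon_ideal | by rewrite /colon mul1r |].
rewrite /colon => g h Jghv.
have [Jhv | nJhv] := classic (J (h * v)); [by right | left].
apply: (maxv (h * v)); rewrite // ?mulrA //.
by move=> k Jkv; rewrite mulrCA; apply: (ideal_Ml idJ).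
Qed.

Lemma maximal_ann_exists J u : ideal J -> ~ J u ->
  exists2 v, maximal_ann J v & forall g, J (g * u) -> J (g * v).
Proof.
move=> idJ.
suff maxL L : ideal L -> forall u, L = colon J u -> ~ J u ->
    exists2 v, maximal_ann J v & forall g, J (g * u) -> J (g * v).
  exact: (maxL (colon J u) (colon_ideal u idJ)).
move: L; apply: noethR => L idL IHL {}u defL Ju.
have [maxu | ] := classic (maximal_ann J u); first by exists u.
move=> nmaxu; apply: NNPP => no_v; apply: nmaxu; split=> // w Jw uw g Jgw.
apply: NNPP => Jgu; apply: no_v.
have Lw : strict_sub L (colon J w) by rewrite defL; split=> //; exists g.
have [v maxv wv] := IHL _ (colon_ideal w idJ) Lw w erefl Jw.
by exists v => // h /uw; apply: wv.
Qed.

Lemma adds_ann J vs p : ideal J -> (forall v, v \in vs -> J (p * v)) ->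
  forall f, adds J vs f -> J (p * f).
Proof.
move=> idJ; elim: vs => [_ f | v vs IHvs Jpvs f] /=; first exact: (ideal_Ml idJ).
rewrite adds_addI // => -[a] /IHvs.
rewrite mulrBr => Jp; have {Jp}: J (p * f - p * (a * v)).
  by apply: Jp => w wvs; apply: Jpvs; rewrite in_cons wvs orbT.
move/(ideal_congr idJ); apply; rewrite mulrCA; apply: (ideal_Ml idJ).
by apply: Jpvs; rewrite mem_head.
Qed.

(** An element killing every class [v] kills the combination [w] of them, so the product
 of the primes [J : v] lies in the prime [J : w], which then contains one of them. *)
Lemma maximal_ann_mem J vs w : ideal J -> (forall v, v \in vs -> maximal_ann J v) ->
  maximal_ann J w -> adds J vs w -> exists2 v, v \in vs & colon J v = colon J w.
Proof.
move=> idJ maxvs maxw Jvsw; have [_ _ primew] := maximal_ann_prime idJ maxw.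
case: (maxw) => Jw _; apply: NNPP => no_v.
have [p Jpw Jpvs]: exists2 p, ~ J (p * w) & forall v, v \in vs -> J (p * v).
  elim: vs maxvs no_v {Jvsw} => [|v vs IHvs] maxvs no_v; first by exists 1; rewrite ?mul1r.
  have [||p Jpw Jpvs] := IHvs.
  - by move=> v' vsv'; apply: maxvs; rewrite in_cons vsv' orbT.
  - by case=> v' vsv' eqv'; apply: no_v; exists v'; rewrite // in_cons vsv' orbT.
  have [q Jqv Jqw]: exists2 q, J (q * v) & ~ J (q * w).
    apply: NNPP => no_q; apply: no_v; exists v; first exact: mem_head.
    have vw g : J (g * v) -> J (g * w).
      by move=> Jgv; apply: NNPP => Jgw; apply: no_q; exists g.
    have [_ maxv] := maxvs v (mem_head v vs).
    by apply: pred_ext => g; split; [apply: vw | apply: maxv].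
  exists (p * q); first by case/primew.
  move=> v'; rewrite in_cons => /predU1P [-> | /Jpvs Jpv'].
    by rewrite -mulrA; apply: (ideal_Ml idJ).
  by rewrite mulrAC; apply: (ideal_Mr idJ).
by apply: Jpw; apply: adds_ann Jvsw.
Qed.

(** By [maximal_ann_mem] the witness [w] of a new prime lies outside the ideal generated
 over [J] by the witnesses already listed, so the list strictly enlarges that ideal. *)
Lemma maximal_ann_finite J : ideal J -> exists2 vs : seq R,
    forall v, v \in vs -> maximal_ann J v &
    forall w, maximal_ann J w -> exists2 v, v \in vs & colon J v = colon J w.
Proof.
move=> idJ.
suff fin L : ideal L -> forall vs, L = adds J vs -> (forall v, v \in vs -> maximal_ann J v) ->
    exists2 vs : seq R, forall v, v \in vs -> maximal_ann J v &
      forall w, maximal_ann J w -> exists2 v, v \in vs & colon J v = colon J w.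
  exact: (fin J idJ [::]).
move: L; apply: noethR => L idL IHL vs defL maxvs.
apply: NNPP => no_vs; apply: (no_vs); exists vs => // w maxw.
apply: NNPP => new_w; apply: no_vs.
have nLw : ~ L w by rewrite defL => /(maximal_ann_mem idJ maxvs maxw).
apply: (IHL (addI L w) (addI_ideal w idL) (strict_addI nLw idL) (w :: vs)).
  by rewrite /= adds_addI // defL.
by move=> v; rewrite in_cons => /predU1P [-> | /maxvs].
Qed.

(** If every element of [E] is a zero divisor modulo [J], prime avoidance puts [E]
 inside a single [J : v], and [v] spans a nonzero class killed by [E]. *)
Lemma common_regular E (Js : seq (R -> Prop)) : subrng E ->
  (forall J, List.In J Js -> ideal J /\ ~ socle_nz E J) ->
  exists2 e, E e & forall J, List.In J Js -> regular J e.
Proof.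
move=> rngE socJs.
have [ps primeps zdps]: exists2 ps : seq (R -> Prop),
    forall P, List.In P ps -> prime_ideal P /\ exists2 e, E e & ~ P e &
    forall J f, List.In J Js -> ~ regular J f -> exists2 P, List.In P ps & P f.
  elim: Js socJs => [_ | J Js IHJs socJs]; first by exists [::].
  have [|ps primeps zdps] := IHJs; first by move=> L JsL; apply: socJs; right.
  have [idJ nsoc] := socJs J (or_introl erefl).
  have [vs maxvs allvs] := maximal_ann_finite idJ.
  exists (map (colon J) vs ++ ps).
    move=> P /(List.in_app_or _ _ _) [|/primeps //].
    elim: vs maxvs {allvs} => //= v vs IHvs maxvs [<- | vsP]; last first.
      by apply: IHvs => // w wvs; apply: maxvs; rewrite in_cons wvs orbT.
    have maxv := maxvs v (mem_head v vs); split; first exact: maximal_ann_prime.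
    apply: NNPP => no_e; apply: nsoc; exists v; first by case: maxv.
    by move=> e Ee; apply: NNPP => Jev; apply: no_e; exists e.
  move=> L f [<- | JsL] zd; last first.
    have [P psP Pf] := zdps L f JsL zd.
    by exists P => //; apply: List.in_or_app; right.
  have [u Jfu Ju]: exists2 u, J (f * u) & ~ J u.
    by apply: NNPP => no_u; apply: zd => u Jfu; apply: NNPP => Ju; apply: no_u; exists u.
  have [w maxw uw] := maximal_ann_exists idJ Ju.
  have [v vsv eqv] := allvs w maxw.
  exists (colon J v); last by rewrite eqv; apply: uw.
  apply: List.in_or_app; left.
  elim: vs vsv {maxvs allvs} => //= v' vs IHvs.
  by rewrite in_cons => /predU1P [-> | /IHvs]; [left | right].
have [e Ee ePs] := prime_avoidance rngE primeps.
exists e => // J JsJ; apply: NNPP => /(zdps J e JsJ) [P psP].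
exact: ePs.
Qed.

Section Depth.
Variables (E : R -> Prop) (rngE : subrng E).

(** Rees' theorem that the lengths of maximal regular sequences agree. A common
 regular element [h] replaces the last terms of [s] and [t] and is then moved to the
 front, which shortens both sequences. *)
Lemma socle_invariant J s t : ideal J -> size s = size t ->
  (forall e, e \in s -> E e) -> (forall e, e \in t -> E e) ->
  regseq J s -> regseq J t -> socle_nz E (adds J s) -> socle_nz E (adds J t).
Proof.
move: {2}(size t) (erefl (size t)) => d; elim: d J s t => [|d IHd] J s t szt idJ sz_st.
  by rewrite (size0nil szt) (size0nil (etrans sz_st szt)).
case/lastP: s sz_st => [|s a]; first by rewrite szt.
case/lastP: t szt => [//|t b]; rewrite !size_rcons => -[szt] [sz_st] Es Et.
move=> regsa regtb.
have [|h Eh regh] := common_regular (Js := stages J s ++ stages J t) rngE.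
  move=> L /(List.in_app_or _ _ _) [].
    exact: stages_socle idJ Es regsa L.
  exact: stages_socle idJ Et regtb L.
have regsh L : List.In L (stages J s) -> regular L h.
  by move=> sL; apply: regh; apply: List.in_or_app; left.
have regth L : List.In L (stages J t) -> regular L h.
  by move=> tL; apply: regh; apply: List.in_or_app; right.
have [/regseq_rcons [regs rega] /regseq_rcons [regt regb]] := (regsa, regtb).
have [idJs idJt] : ideal (adds J s) /\ ideal (adds J t) by split; apply: adds_ideal.
rewrite !adds_rcons => soc_sa.
have Es' e : e \in s -> E e by move=> se; apply: Es; rewrite mem_rcons in_cons se orbT.
have Et' e : e \in t -> E e by move=> te; apply: Et; rewrite mem_rcons in_cons te orbT.
have [Ea Eb] : E a /\ E b by split; [apply: Es | apply: Et]; rewrite mem_rcons mem_head.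
have soc_sh : socle_nz E (adds (addI J h) s).
  rewrite adds_addI //; apply: socle_exchange soc_sa => //.
  by apply: regsh; apply: mem_stages_adds.
have soc_th : socle_nz E (adds (addI J h) t).
  apply: IHd soc_sh => //; [exact: addI_ideal | exact: regseq_move | exact: regseq_move].
rewrite adds_addI // in soc_th; apply: socle_exchange soc_th => //.
by apply: regth; apply: mem_stages_adds.
Qed.

(** A regular sequence with a nonzero socle beyond it cannot be extended; by
 [socle_invariant] its length does not depend on the choices. *)
Definition has_depth J d : Prop := exists s,
  [/\ forall e, e \in s -> E e, regseq J s, size s = d & socle_nz E (adds J s)].

Definition depth_ge J d : Prop := exists s,
  [/\ forall e, e \in s -> E e, regseq J s & size s = d].

Lemma has_depth_ge J d k : has_depth J d -> (k <= d)%N -> depth_ge J k.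
Proof.
move=> [s [Es regs szs _]] lekd; exists (take k s); split.
- by move=> e /mem_take /Es.
- by move: regs; rewrite -{1}(cat_take_drop k s) => /regseq_cat [].
- by rewrite size_takel ?szs.
Qed.

Lemma depth_ge_socle J d s : ideal J -> depth_ge J d -> regseq J s ->
  (forall e, e \in s -> E e) -> (size s < d)%N -> ~ socle_nz E (adds J s).
Proof.
move=> idJ [t [Et regt szt]] regs Es; rewrite -szt => lt_st soc_s.
have def_t := cat_take_drop (size s) t.
case def_a: (drop (size s) t) => [|a r].
  by move: lt_st; rewrite -subn_gt0 -size_drop def_a.
move: regt; rewrite -def_t def_a regseq_cat /= => -[regt [rega _]].
have Ea : E a by apply: Et; rewrite -def_t def_a mem_cat mem_head orbT.
apply: (regular_soc Ea rega); apply: socle_invariant soc_s => //.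
  by rewrite size_takel // ltnW.
by move=> e /mem_take /Et.
Qed.

Lemma has_depth_max J d k : ideal J -> has_depth J d -> depth_ge J k -> (k <= d)%N.
Proof.
move=> idJ [s [Es regs szs soc]] Jk; rewrite leqNgt; apply/negP => lt_dk.
by apply: depth_ge_socle Jk regs Es _ soc; rewrite ?szs.
Qed.

Lemma depth_ge_extend J d s : ideal J -> depth_ge J d -> regseq J s ->
  (forall e, e \in s -> E e) -> (size s <= d)%N ->
  exists t, [/\ forall e, e \in t -> E e, regseq J (s ++ t) & size (s ++ t) = d].
Proof.
move=> idJ Jd; move: {2}(d - size s)%N (erefl (d - size s)%N) => k.
elim: k s => [|k IHk] s szk regs Es le_sd.
  exists [::]; split; rewrite ?cats0 //.
  by apply/eqP; rewrite eqn_leq le_sd -subn_eq0 szk.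
have lt_sd : (size s < d)%N by rewrite -subn_gt0 szk.
have [|e Ee rege] := common_regular (Js := [:: adds J s]) rngE.
  by move=> L [<- | //]; split; [apply: adds_ideal | apply: depth_ge_socle lt_sd].
have rege_s := rege _ (or_introl erefl).
have [||||t [Et regt szt]] := IHk (rcons s e).
- by rewrite size_rcons subnS szk.
- by apply/regseq_rcons.
- by move=> f; rewrite mem_rcons in_cons => /predU1P [-> | /Es].
- by rewrite size_rcons.
exists (e :: t); rewrite -cat_rcons; split=> // f.
by rewrite in_cons => /predU1P [-> | /Et].
Qed.

Lemma depth_ge_quotient J d h : ideal J -> E h -> regular J h ->
  depth_ge J d.+1 -> depth_ge (addI J h) d.
Proof.
move=> idJ Eh regh Jd.
have [|||t [Et [_ regt] [szt]]] := @depth_ge_extend J d.+1 [:: h] idJ Jd => //.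
  by move=> e; rewrite mem_seq1 => /eqP ->.
by exists t.
Qed.

Lemma has_depth_quotient J d h : ideal J -> E h -> regular J h ->
  has_depth J d.+1 -> has_depth (addI J h) d.
Proof.
move=> idJ Eh regh Jd.
have [t [Et regt szt]] := depth_ge_quotient idJ Eh regh (has_depth_ge Jd (leqnn _)).
exists t; split=> //; case: Jd => s [Es regs szs soc_s].
apply: (@socle_invariant J s (h :: t)) => //; first by rewrite szs /= szt.
by move=> e; rewrite in_cons => /predU1P [-> | /Et].
Qed.

(** The exact sequence [0 -> R/(J : x) -> R/J -> R/(J + x) -> 0]. A regular element
 common to the two outer terms is regular on the middle one and keeps the sequence
 exact; in depth [0] the socle of the left term embeds by multiplication by [x]. *)
Lemma has_depth_colon J x d : ideal J -> has_depth (colon J x) d ->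
  depth_ge (addI J x) d -> has_depth J d.
Proof.
elim: d J => [|d IHd] J idJ dcolon dadd.
  case: dcolon => s [_ _ /size0nil-> [u /= Ju Eu]].
  exists [::]; split=> //; exists (u * x) => // e Ee.
  by rewrite mulrA; apply: Eu.
have [idc ida] : ideal (colon J x) /\ ideal (addI J x).
  by split; [apply: colon_ideal | apply: addI_ideal].
have [|h Eh regh] := common_regular (Js := [:: colon J x; addI J x]) rngE.
  move=> L [<- | [<- | //]]; split=> //.
    exact: (@depth_ge_socle _ d.+1 [::] idc (has_depth_ge dcolon (leqnn _))).
  exact: (@depth_ge_socle _ d.+1 [::] ida dadd).
have [reghc regha] : regular (colon J x) h /\ regular (addI J x) h.
  by split; apply: regh; [left | right; left].
have reghJ : regular J h.
  move=> g Jhg; have [a Jgax] := regha g (sub_addI x Jhg).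
  apply: (ideal_congr idJ Jgax); apply: (reghc a); rewrite /colon -mulrA.
  rewrite (_ : _ * _ = h * g - h * (g - a * x)); last by ring.
  by apply: (ideal_B idJ) => //; apply: (ideal_Ml idJ).
have def_colon : colon (addI J h) x = addI (colon J x) h.
  apply: pred_ext => f; split=> [[c Jc] | [c Jc]]; last first.
    by exists (c * x); rewrite mulrAC -mulrBl.
  have [|a Ja] := regha c.
    exists f; rewrite (_ : _ - _ = - (f * x - c * h)); last by ring.
    exact: (ideal_N idJ).
  exists a; rewrite /colon (_ : _ * _ = (f * x - c * h) + h * (c - a * x)); last by ring.
  by apply: (ideal_D idJ) => //; apply: (ideal_Ml idJ).
have [||s [Es regs szs soc]] := IHd (addI J h) (addI_ideal h idJ).
- by rewrite def_colon; apply: has_depth_quotient.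
- by rewrite addIC //; apply: depth_ge_quotient.
exists (h :: s); split=> //=; last by rewrite szs.
by move=> e; rewrite in_cons => /predU1P [-> | /Es].
Qed.

(** Maximal regular sequences exist because each regular element enlarges the ideal. *)
Lemma has_depth_exists J L : ideal J -> ideal L -> ~ L 1 ->
  (forall f, J f -> L f) -> (forall e, E e -> L e) -> exists d, has_depth J d.
Proof.
move=> idJ idL L1 + EL.
move: J idJ; apply: noethR => J idJ IHJ JL.
have [soc | nsoc] := classic (socle_nz E J); first by exists 0%N, [::]; split.
have [|h Eh regh] := common_regular (Js := [:: J]) rngE; first by move=> I' [<- | //].
have {}regh := regh J (or_introl erefl).
have nJh : ~ J h.
  by move=> Jh; apply: L1; apply: JL; apply: regh; rewrite mulr1.
have [|d [s [Es regs szs soc]]] := IHJ _ (addI_ideal h idJ) (strict_addI nJh idJ).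
  by apply: addI_sub => //; apply: EL.
exists d.+1, (h :: s); split=> //=; last by rewrite szs.
by move=> e; rewrite in_cons => /predU1P [-> | /Es].
Qed.

End Depth.
End Noetherian.
End Ideals.

(** * Noetherianity of polynomial rings *)

Lemma choice_fun (T U : Type) (P : T -> U -> Prop) :
  (forall x, exists y, P x y) -> exists f, forall x, P x (f x).
Proof.
move=> ex; exists (fun x => proj1_sig (constructive_indefinite_description _ (ex x))).
by move=> x; case: constructive_indefinite_description.
Qed.

Lemma nondecreasing_subsequence (u : nat -> nat) : exists2 phi : nat -> nat,
  {homo phi : i j / (i < j)%N} & {homo u \o phi : i j / (i <= j)%N}.
Proof.
have ex_min i : exists j, (i < j)%N /\ forall k, (i < k)%N -> (u j <= u k)%N.
  suff min v k : (i < k)%N -> (u k <= v)%N ->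
      exists j, (i < j)%N /\ forall k, (i < k)%N -> (u j <= u k)%N.
    exact: (min (u i.+1) i.+1).
  elim: v k => [|v IHv] k lt_ik le_kv; first by exists k; split=> // l _; lia.
  have [[l lt_il lt_lk] | no_l] := classic (exists2 l, (i < l)%N & (u l < u k)%N).
    by apply: (IHv l) => //; lia.
  exists k; split=> // l lt_il; rewrite leqNgt; apply/negP => lt_lk.
  by apply: no_l; exists l.
have [nx nxP] := choice_fun ex_min.
exists (fun i => iter i.+1 nx 0%N).
  by apply: homo_ltn => [|i]; [exact: ltn_trans | case: (nxP (iter i.+1 nx 0%N))].
apply: homo_leq => [//||i]; first exact: leq_trans.
have [lt_i _] := nxP (iter i nx 0%N); have [lt_i1 _] := nxP (iter i.+1 nx 0%N).
by have [_] := nxP (iter i nx 0%N); apply; apply: ltn_trans lt_i1.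
Qed.

(** Extracting one coordinate at a time yields a subsequence that is nondecreasing in
 every coordinate. *)
Lemma dickson n (a : nat -> 'X_{1..n}) : exists i j, (i < j)%N /\ (a i <= a j)%MM.
Proof.
suff subseq k : (k <= n)%N -> exists2 phi : nat -> nat, {homo phi : i j / (i < j)%N} &
    forall c : 'I_n, (c < k)%N -> {homo (fun i => a (phi i) c) : i j / (i <= j)%N}.
  have [phi phi_lt a_le] := subseq n (leqnn n).
  exists (phi 0%N), (phi 1%N); split; first exact: phi_lt.
  by apply/mnm_lepP => c; apply: a_le.
elim: k => [|k IHk] lekn; first by exists id.
have [phi phi_lt a_le] := IHk (ltnW lekn).
have [psi psi_lt b_le] := nondecreasing_subsequence (fun i => a (phi i) (Ordinal lekn)).
exists (phi \o psi) => [i j lt_ij | c]; first by apply: phi_lt; apply: psi_lt.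
have psi_le : {homo psi : i j / (i <= j)%N}.
  by move=> i j; rewrite leq_eqVlt => /predU1P [-> // | /psi_lt /ltnW].
rewrite ltnS leq_eqVlt => /predU1P [def_c | lt_ck] i j le_ij; last first.
  by apply: a_le => //; apply: psi_le.
rewrite (_ : c = Ordinal lekn); last exact: val_inj.
exact: b_le.
Qed.

Section Noetherian.
Variables (K : fieldType) (n : nat).
Local Notation S := {mpoly K[n]}.
Implicit Types (J L : S -> Prop) (f g F G : S) (m : 'X_{1..n}).

Lemma mlead_cancel f g : f != 0 -> g != 0 -> mlead g = mlead f ->
  let h := f - (mleadc f / mleadc g) *: g in h = 0 \/ (mlead h < mlead f)%O.
Proof.
move=> nz_f nz_g eq_lead h; have [h0 | nz_h] := eqVneq h 0; [by left | right].
have le_lead : (mlead h <= mlead f)%O.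
  apply: le_trans (mleadB_le _ _) _; rewrite leUx lexx /=.
  by apply: le_trans (mleadZ_le _ _) _; rewrite eq_lead.
rewrite lt_neqAle le_lead andbT; apply/eqP => eq_h.
have := mlead_supp nz_h; rewrite mcoeff_msupp eq_h mcoeffB mcoeffZ.
by rewrite -eq_lead divfK ?subrr ?eqxx // mleadc_eq0.
Qed.

(** Otherwise the leading monomial of an element of [L] outside [J] could be cancelled by
 an element of [J] again and again, against the well-foundedness of the order. *)
Lemma new_mlead J L : ideal J -> ideal L -> strict_sub J L ->
  exists f, [/\ L f, f != 0 & forall g, J g -> g != 0 -> mlead g <> mlead f].
Proof.
move=> idJ idL [JL [f Lf Jf]]; elim/mleadrect: f Lf Jf => f IHf Lf Jf.
have nz_f : f != 0 by apply/eqP => f0; apply: Jf; rewrite f0; exact: ideal_0.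
apply: NNPP => nof; apply: (nof); exists f; split=> // g Jg nz_g eq_lead.
have Jcg : J ((mleadc f / mleadc g) *: g) by rewrite -mul_mpolyC; apply: (ideal_Ml idJ).
have [h0 | lt_h] := mlead_cancel nz_f nz_g eq_lead.
  by apply: Jf; apply: (ideal_congr idJ) Jcg; rewrite h0; apply: ideal_0.
apply: nof; apply: (IHf _ lt_h); first by apply: (ideal_B idL) => //; apply: JL.
by move/(ideal_congr idJ)/(_ Jcg).
Qed.

(** Hilbert's basis theorem, as an induction principle: a strictly increasing chain would
 bring a new leading monomial at each step, against Dickson's lemma. *)
Lemma mpoly_noetherian (Q : (S -> Prop) -> Prop) :
  (forall J, ideal J -> (forall L, ideal L -> strict_sub J L -> Q L) -> Q J) ->
  forall J, ideal J -> Q J.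
Proof.
move=> stepQ J idJ; apply: NNPP => nQJ.
have ex_L L : exists M, ideal L /\ ~ Q L -> [/\ ideal M, ~ Q M & strict_sub L M].
  apply: NNPP => noM; apply: (noM); exists L => -[idL nQL].
  case: nQL; apply: stepQ => // M idM LM.
  by apply: NNPP => nQM; apply: noM; exists M.
have [nx nxP] := choice_fun ex_L.
pose c i := iter i nx J.
have cP i : ideal (c i) /\ ~ Q (c i) by elim: i => //= i /nxP [].
have sub_c i : strict_sub (c i) (c i.+1) by case: (nxP (c i) (cP i)).
have sub_cc i j f : (i <= j)%N -> c i f -> c j f.
  move=> /subnK <-; elim: (j - i)%N => //= k IHk /IHk.
  by case: (sub_c (k + i)%N) => sub_k _ /sub_k.
have ex_f i := new_mlead (proj1 (cP i)) (proj1 (cP i.+1)) (sub_c i).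
have [f fP] := choice_fun ex_f.
have [i [j [lt_ij le_m]]] := dickson (fun i => mlead (f i)).
have [cf nz_f _] := fP i; have [_ _ new_j] := fP j.
have nz_X : 'X_[mlead (f j) - mlead (f i)] != 0 :> S.
  by rewrite -msupp_eq0 msuppX.
apply: (new_j ('X_[mlead (f j) - mlead (f i)] * f i)).
- by apply: sub_cc lt_ij _; apply: ideal_Ml => //; case: (cP i.+1).
- by rewrite mulf_neq0.
- by rewrite mleadM // mleadXm submK.
Qed.

(** The standard monomials of [J], those that lead no element of [J], span a
 complement of [J]; [G] below is the normal form of [F]. *)
Lemma normal_form_exists J F : ideal J -> exists G, J (F - G) /\
  forall m, m \in msupp G -> forall g, J g -> g != 0 -> mlead g <> m.
Proof.
move=> idJ; elim/mleadrect: F => F IHF.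
have [-> | nz_F] := eqVneq F 0.
  by exists 0; split=> [|m]; rewrite ?subrr ?msupp0 //; apply: ideal_0.
have step g : g != 0 -> mlead g = mlead F ->
    exists G, J (F - (mleadc F / mleadc g) *: g - G) /\
    forall m, m \in msupp G -> forall g, J g -> g != 0 -> mlead g <> m.
  move=> nz_g eq_lead; have [-> | /IHF //] := mlead_cancel nz_F nz_g eq_lead.
  by exists 0; split=> [|m]; rewrite ?subrr ?msupp0 //; apply: ideal_0.
have [[g [Jg nz_g eq_lead]] | std] :=
    classic (exists g, [/\ J g, g != 0 & mlead g = mlead F]).
  have [G [JG redG]] := step g nz_g eq_lead; exists G; split=> //.
  rewrite -(subrK ((mleadc F / mleadc g) *: g) F) addrAC.
  by apply: (ideal_D idJ) => //; rewrite -mul_mpolyC; apply: (ideal_Ml idJ).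
have nz_X : 'X_[mlead F] != 0 :> S by rewrite -msupp_eq0 msuppX.
have [G [JG redG]] := step 'X_[mlead F] nz_X (mleadXm _ _).
exists (G + (mleadc F / mleadc ('X_[mlead F] : S)) *: 'X_[mlead F]); split.
  by rewrite opprD addrA addrAC.
move=> m /msuppD_le; rewrite mem_cat => /orP [/redG // | /msuppZ_le].
by rewrite msuppX mem_seq1 => /eqP -> g Jg nz_g eq_lead; apply: std; exists g.
Qed.

(** Normal forms are unique, which makes them linear. *)
Lemma normal_form J : ideal J -> exists nf : S -> S,
  [/\ forall F, J (F - nf F), forall F, J F -> nf F = 0,
      forall F G, nf (F + G) = nf F + nf G & forall c F, nf (c *: F) = c *: nf F].
Proof.
move=> idJ.
have [nf nfP] := choice_fun (fun F => normal_form_exists F idJ).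
have nf0 G : J G ->
    (forall m, m \in msupp G -> forall g, J g -> g != 0 -> mlead g <> m) -> G = 0.
  move=> JG redG; apply/eqP; case: eqVneq => // nz_G.
  by case: (redG (mlead G) (mlead_supp nz_G) G JG nz_G).
exists nf; split=> [F | F JF | F G | c F].
- by case: (nfP F).
- have [JF' red] := nfP F; apply: nf0 => //.
  by rewrite -(subKr F (nf F)); apply: (ideal_B idJ).
- have [JF redF] := nfP F; have [JG redG] := nfP G; have [JFG redFG] := nfP (F + G).
  apply/eqP; rewrite -subr_eq0; apply/eqP; apply: nf0.
    rewrite (_ : _ - _ = (F - nf F) + (G - nf G) - (F + G - nf (F + G))); last by ring.
    by apply: (ideal_B idJ) => //; apply: (ideal_D idJ).
  move=> m /msuppB_le; rewrite mem_cat => /orP [/redFG // | /msuppD_le].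
  by rewrite mem_cat => /orP [/redF | /redG].
- have [JF redF] := nfP F; have [JcF redcF] := nfP (c *: F).
  apply/eqP; rewrite -subr_eq0; apply/eqP; apply: nf0.
    rewrite (_ : _ - _ = c *: (F - nf F) - (c *: F - nf (c *: F))).
      by apply: (ideal_B idJ) => //; rewrite -mul_mpolyC; apply: (ideal_Ml idJ).
    by rewrite scalerBr opprB [RHS]addrC addrA subrK.
  by move=> m /msuppB_le; rewrite mem_cat => /orP [/redcF // | /msuppZ_le /redF].
Qed.

End Noetherian.

(** * Blocks of variables *)

Section Restriction.
Variable n : nat.
Implicit Types (A B : {set 'I_n}) (m : 'X_{1..n}).

Definition rst A m : 'X_{1..n} := [multinom if i \in A then m i else 0%N | i < n].

Lemma rstE A m i : rst A m i = if i \in A then m i else 0%N.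
Proof. exact: mnmE. Qed.

Lemma rst_split A m : (rst A m + rst (~: A) m)%MM = m.
Proof. by apply/mnmP => i; rewrite mnmDE !rstE inE; case: ifP; rewrite ?addn0. Qed.

Lemma rstD A m1 m2 : rst A (m1 + m2)%MM = (rst A m1 + rst A m2)%MM.
Proof. by apply/mnmP => i; rewrite mnmDE !rstE mnmDE; case: ifP. Qed.

Lemma rst0 A : rst A 0%MM = 0%MM.
Proof. by apply/mnmP => i; rewrite rstE mnm0E if_same. Qed.

Lemma rst_idP A m : (forall i, i \notin A -> m i = 0%N) <-> rst A m = m.
Proof.
split=> [mA | <- i /negPf]; last by rewrite rstE => ->.
by apply/mnmP => i; rewrite rstE; case: ifP => // /negbT /mA ->.
Qed.

Lemma rst_rst A B m : rst A (rst B m) = rst (A :&: B) m.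
Proof. by apply/mnmP => i; rewrite !rstE inE; case: (i \in A). Qed.

Lemma rst_id A m : rst A (rst A m) = rst A m.
Proof. by rewrite rst_rst setIid. Qed.

Lemma rst_disjoint A B m : [disjoint A & B] -> rst A m = m -> rst B m = 0%MM.
Proof.
move=> disAB <-; rewrite rst_rst setIC; move: disAB.
rewrite -setI_eq0 => /eqP ->.
by apply/mnmP => i; rewrite rstE inE mnm0E.
Qed.

Lemma rst_sub A B m : A \subset B -> rst A m = m -> rst B m = m.
Proof. by move=> sAB <-; rewrite rst_rst (setIidPr sAB). Qed.

Lemma rstU A m i : i \in A -> rst A (U_(i) + m)%MM = (U_(i) + rst A m)%MM.
Proof.
move=> Ai; rewrite rstD; congr (_ + _)%MM; apply/mnmP => j; rewrite rstE mnm1E.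
by case: eqP => [<- | _]; rewrite ?Ai ?if_same.
Qed.

Lemma mdeg_rst A m : (mdeg (rst A m) <= mdeg m)%N.
Proof. by rewrite -{2}(rst_split A m) mdegD leq_addr. Qed.

End Restriction.

Section Blocks.
Variables (K : fieldType) (n : nat).
Local Notation S := {mpoly K[n]}.
Implicit Types (A B : {set 'I_n}) (m a b : 'X_{1..n}) (f g F G e u : S) (J : S -> Prop).

Lemma poly_inP A F : poly_in A F <-> forall m, m \in msupp F -> rst A m = m.
Proof. by split=> FA m /FA /rst_idP. Qed.

Lemma poly_in0 A : poly_in A (0 : S).
Proof. by move=> m; rewrite msupp0. Qed.

Lemma poly_inX A m : rst A m = m -> poly_in A ('X_[m] : S).
Proof. by move=> mA; apply/poly_inP => m'; rewrite msuppX mem_seq1 => /eqP ->. Qed.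

Lemma poly_inD A F G : poly_in A F -> poly_in A G -> poly_in A (F + G).
Proof. by move=> FA GA m /msuppD_le; rewrite mem_cat => /orP [/FA | /GA]. Qed.

Lemma poly_inZ A c F : poly_in A F -> poly_in A (c *: F).
Proof. by move=> FA m /msuppZ_le /FA. Qed.

Lemma poly_inM A F G : poly_in A F -> poly_in A G -> poly_in A (F * G).
Proof.
move=> /poly_inP FA /poly_inP GA; apply/poly_inP => m /msuppM_le.
by case/allpairsP => -[m1 m2] [/= /FA m1A /GA m2A ->]; rewrite rstD m1A m2A.
Qed.

Lemma poly_in_sum A (I : Type) (r : seq I) (P : pred I) (F : I -> S) :
  (forall i, P i -> poly_in A (F i)) -> poly_in A (\sum_(i <- r | P i) F i).
Proof.
by move=> FA; apply: (big_ind (poly_in A)) => //; [apply: poly_in0 | apply: poly_inD].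
Qed.

Lemma poly_in_sub A B F : A \subset B -> poly_in A F -> poly_in B F.
Proof. by move=> sAB /poly_inP FA; apply/poly_inP => m /FA /(rst_sub sAB). Qed.

Lemma poly_inT F : poly_in setT F.
Proof. by move=> m _ i; rewrite inE. Qed.

Lemma disjoint_subC A B : [disjoint A & B] -> B \subset ~: A.
Proof. by rewrite disjoint_sym disjoints_subset. Qed.

Definition lin (nu : 'X_{1..n} -> S) F : S := \sum_(m <- msupp F) F@_m *: nu m.

Section Lin.
Variable nu : 'X_{1..n} -> S.

Lemma linwE k F : (msize F <= k)%N -> lin nu F = \sum_(m : 'X_{1..n < k}) F@_m *: nu m.
Proof.
move=> le_k; pose I : subFinType _ := 'X_{1..n < k}.
rewrite /lin (big_mksub I) ?msupp_uniq //=; last first.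
  by move=> m /msize_mdeg_lt /leq_trans; apply.
by rewrite big_rmcond //= => m /memN_msupp_eq0 ->; rewrite scale0r.
Qed.

Lemma linD F G : lin nu (F + G) = lin nu F + lin nu G.
Proof.
pose k := maxn (msize F) (msize G).
rewrite !(@linwE k) ?leq_maxl ?leq_maxr ?(leq_trans (msizeD_le _ _)) //.
by rewrite -big_split; apply: eq_bigr => m _; rewrite mcoeffD scalerDl.
Qed.

Lemma linZ c F : lin nu (c *: F) = c *: lin nu F.
Proof.
rewrite !(@linwE (msize F)) ?msizeZ_le // scaler_sumr.
by apply: eq_bigr => m _; rewrite mcoeffZ scalerA.
Qed.

Lemma lin0 : lin nu 0 = 0.
Proof. by rewrite /lin msupp0 big_nil. Qed.

Lemma lin_sum (I : Type) (r : seq I) (P : pred I) (F : I -> S) :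
  lin nu (\sum_(i <- r | P i) F i) = \sum_(i <- r | P i) lin nu (F i).
Proof. exact: (big_morph _ linD lin0). Qed.

Lemma linX m : lin nu 'X_[m] = nu m.
Proof. by rewrite /lin msuppX big_seq1 mcoeffX eqxx scale1r. Qed.

Lemma linM A g F : poly_in A g ->
  (forall a m, rst A a = a -> nu (a + m)%MM = 'X_[a] * nu m) ->
  lin nu (g * F) = g * lin nu F.
Proof.
move=> /poly_inP gA nuA; rewrite [g]mpolyE !mulr_suml lin_sum.
rewrite !big_seq; apply: eq_bigr => a /gA aA.
rewrite -!scalerAl linZ {1}[F]mpolyE mulr_sumr lin_sum [in RHS]/lin mulr_sumr; congr (_ *: _).
by apply: eq_bigr => m _; rewrite -!scalerAr linZ -mpolyXD linX nuA.
Qed.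

End Lin.

(** Over the polynomials in the variables of [A], the coefficient of the monomial [b]
 in the variables outside [A]. *)
Definition bcoef A b : S -> S :=
  lin (fun m => if rst (~: A) m == b then 'X_[rst A m] else 0).

Lemma bcoef_in A b F : poly_in A (bcoef A b F).
Proof.
apply: poly_in_sum => m _; apply: poly_inZ; case: ifP => _; last exact: poly_in0.
by apply: poly_inX; rewrite rst_id.
Qed.

Lemma bcoefM A b g F : poly_in A g -> bcoef A b (g * F) = g * bcoef A b F.
Proof.
move=> gA; apply: linM gA _ => a m aA.
rewrite rstD (rst_disjoint _ aA) ?add0m; last by rewrite -setI_eq0 setICr.
by case: ifP; rewrite ?mulr0 // rstD aA mpolyXD.
Qed.

Lemma bcoef_id A F : poly_in A F -> bcoef A 0%MM F = F.
Proof.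
move=> /poly_inP FA; rewrite [RHS]mpolyE /bcoef /lin !big_seq; apply: eq_bigr => m /FA mA.
rewrite (rst_disjoint _ mA) ?eqxx ?mA //.
by rewrite -setI_eq0 setICr.
Qed.

Lemma bcoef_eq0 A b F : rst (~: A) b != b -> bcoef A b F = 0.
Proof.
move=> bA; rewrite /bcoef /lin big1 // => m _; case: eqP => [def_b | _]; last exact: scaler0.
by move: bA; rewrite -def_b rst_id eqxx.
Qed.

Lemma bcoef_sum A F k : (msize F <= k)%N ->
  F = \sum_(b : 'X_{1..n < k}) bcoef A b F * 'X_[b].
Proof.
move=> le_k; rewrite [LHS](mpolywE le_k).
under [RHS]eq_bigr => b _ do rewrite /bcoef (linwE _ le_k) mulr_suml.
rewrite exchange_big /=; apply: eq_bigr => m _.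
have ltk : (mdeg (rst (~: A) m) < k)%N := leq_ltn_trans (mdeg_rst _ _) (bmdeg m).
rewrite (bigD1 (BMultinom ltk)) //= eqxx -scalerAl -mpolyXD rst_split big1 ?addr0 //.
move=> b neq_b; case: eqP => [def_b | _]; last by rewrite scaler0 mul0r.
by case/eqP: neq_b; apply: val_inj.
Qed.

Lemma ideal_bcoef A J F : ideal J -> (forall b, J (bcoef A b F)) -> J F.
Proof.
move=> idJ JF; rewrite (bcoef_sum A (leqnn (msize F))).
by apply: (ideal_sum idJ) => b _; apply: (ideal_Mr idJ).
Qed.

(** An ideal is generated by polynomials in the variables of [A] exactly when it is stable
 under taking block coefficients. *)
Definition generated_in A J : Prop := ideal J /\ forall b F, J F -> J (bcoef A b F).

Lemma generated_in_addI A J f : generated_in A J -> poly_in A f ->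
  generated_in A (addI J f).
Proof.
move=> [idJ JA] fA; split=> [|b F [a Jaf]]; first exact: addI_ideal.
exists (bcoef A b a); rewrite mulrC -bcoefM //.
have -> : bcoef A b F = bcoef A b (F - a * f) + bcoef A b (f * a).
  by rewrite -[LHS]/(lin _ _) -linD mulrC subrK.
by rewrite addrK; apply: JA.
Qed.

Lemma generated_in_adds A J s : generated_in A J -> (forall f, f \in s -> poly_in A f) ->
  generated_in A (adds J s).
Proof.
elim: s J => //= f s IHs J JA sA; apply: IHs => [|g sg].
  by apply: generated_in_addI => //; apply: sA; rewrite mem_head.
by apply: sA; rewrite in_cons sg orbT.
Qed.

(** A projection with kernel [J] that is linear over the polynomials in the variables
 outside [A]: the normal form modulo [J] is applied to each coefficient. It witnesses
 that [S/J] is free over these polynomials. *)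
Lemma block_projection A J : generated_in A J -> exists phi : S -> S,
  [/\ forall F, J (F - phi F), forall F, J F -> phi F = 0,
      forall F G, phi (F + G) = phi F + phi G,
      forall F, poly_in A F -> poly_in A (phi F) &
      forall g F, poly_in (~: A) g -> phi (g * F) = g * phi F].
Proof.
move=> [idJ JA]; have [nf [nfJ nf0 nfD nfZ]] := normal_form idJ.
pose nu m := bcoef A 0%MM (nf 'X_[rst A m]) * 'X_[rst (~: A) m].
have disA : [disjoint A & ~: A] by rewrite -setI_eq0 setICr.
have linA g F : poly_in (~: A) g -> lin nu (g * F) = g * lin nu F.
  move=> gA; apply: linM gA _ => a m aA.
  rewrite /nu !rstD (rst_disjoint _ aA) 1?disjoint_sym // add0m aA mpolyXD.
  by rewrite mulrCA.
have nf_sum (I : Type) (r : seq I) (P : pred I) (F : I -> S) :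
    nf (\sum_(i <- r | P i) F i) = \sum_(i <- r | P i) nf (F i).
  by apply: (big_morph _ nfD); apply: nf0; apply: ideal_0.
have linK F : poly_in A F -> lin nu F = bcoef A 0%MM (nf F).
  move=> /poly_inP FA; rewrite {2}[F]mpolyE nf_sum [RHS]lin_sum /lin !big_seq.
  apply: eq_bigr => m /FA mA; rewrite nfZ -/(lin _ _) linZ /nu mA.
  by rewrite (rst_disjoint disA mA) mpolyX0 mulr1.
exists (lin nu); split=> [F | F JF | F G | F FA | g F gA].
- rewrite {1}[F]mpolyE /lin -sumrB; apply: (ideal_sum idJ) => m _.
  rewrite -scalerBr -mul_mpolyC; apply: (ideal_Ml idJ).
  have XA : poly_in A ('X_[rst A m] : S) by apply: poly_inX; rewrite rst_id.
  rewrite -{1}(rst_split A m) mpolyXD /nu -mulrBl; apply: (ideal_Mr idJ).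
  rewrite -{1}(bcoef_id XA) -[- _]scaleN1r -linZ scaleN1r -linD.
  by apply: JA; apply: nfJ.
- rewrite (bcoef_sum A (leqnn (msize F))) lin_sum big1 // => b _; rewrite mulrC.
  have [bA | /bcoef_eq0 ->] := eqVneq (rst (~: A) b) b; last by rewrite mulr0 lin0.
  rewrite linA; last exact: poly_inX.
  rewrite linK ?nf0; [|exact: JA|exact: bcoef_in].
  by rewrite /bcoef lin0 mulr0.
- exact: linD.
- by rewrite linK //; apply: bcoef_in.
- exact: linA.
Qed.

End Blocks.

(** * Depth of a tensor product over the field *)

Section Tensor.
Variables (K : fieldType) (n : nat).
Local Notation S := {mpoly K[n]}.
Implicit Types (A B : {set 'I_n}) (m a b : 'X_{1..n}) (f g F G e u : S) (J : S -> Prop).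

(** The homogeneous maximal ideal of the polynomial ring in the variables of [A]: depth on
 the block [A] is measured by regular sequences inside it. *)
Definition aug A e : Prop := poly_in A e /\ e@_0%MM = 0.

Lemma mcoeff0M f g : (f * g)@_0%MM = f@_0%MM * g@_0%MM.
Proof. exact: rmorphM. Qed.

Lemma subrng_aug A : subrng (aug A).
Proof.
split; first by split; [apply: poly_in0 | rewrite mcoeff0].
  move=> f g [fA f0] [gA g0]; split; first exact: poly_inD.
  by rewrite mcoeffD f0 g0 addr0.
move=> f g [fA f0] [gA g0]; split; first exact: poly_inM.
by rewrite mcoeff0M f0 mul0r.
Qed.

Lemma augX A i : i \in A -> aug A 'X_i.
Proof.
move=> Ai; split; last by rewrite mcoeffX mnm1_eq0.
apply: poly_inX; apply/rst_idP => j Aj; rewrite mnm1E.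
by case: eqP => // def_j; rewrite -def_j Ai in Aj.
Qed.

Lemma aug_sub A B e : A \subset B -> aug A e -> aug B e.
Proof. by move=> sAB [eA e0]; split=> //; apply: poly_in_sub eA. Qed.

Lemma aug_kill A J u : ideal J -> (forall i, i \in A -> J ('X_i * u)) ->
  forall e, aug A e -> J (e * u).
Proof.
move=> idJ JX e [/poly_inP eA e0]; rewrite [e]mpolyE mulr_suml big_seq.
apply: (ideal_sum idJ) => m em; rewrite -scalerAl -mul_mpolyC; apply: (ideal_Ml idJ).
have [i mi]: exists i, m i != 0%N.
  apply/existsP; apply: contraTT em => /existsPn m0; rewrite mcoeff_msupp negbK.
  suff -> : m = 0%MM by rewrite e0.
  by apply/mnmP => i; rewrite mnm0E; apply/eqP; rewrite -[_ == _]negbK.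
have Ai : i \in A.
  by apply: contraR mi => Ai; apply/eqP; move/rst_idP: (eA m em); apply.
rewrite -(submK (m := U_(i)%MM) (m' := m)); last by rewrite lep1mP.
by rewrite mpolyXD -mulrA; apply: (ideal_Ml idJ); apply: JX.
Qed.

(** Block coefficients of a socle element are again killed by [aug A], and one of them is
 nonzero modulo [J]. *)
Lemma socle_in A J : generated_in A J -> socle_nz (aug A) J ->
  exists u, [/\ poly_in A u, ~ J u & forall e, aug A e -> J (e * u)].
Proof.
move=> [idJ JA] [u Ju Eu].
have [b Jb]: exists b, ~ J (bcoef A b u).
  apply: NNPP => no_b; apply: Ju; apply: (ideal_bcoef (A := A) idJ) => b.
  by apply: NNPP => Jb; apply: no_b; exists b.
exists (bcoef A b u); split=> //; first exact: bcoef_in.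
by move=> e Ee; rewrite -bcoefM; [apply: JA; apply: Eu | case: Ee].
Qed.

Section TwoBlocks.
Variables (A B : {set 'I_n}) (J1 J2 : S -> Prop).
Hypotheses (disAB : [disjoint A & B]) (J1A : generated_in A J1) (J2B : generated_in B J2).

Lemma sumI_projection : exists phi : S -> S,
  [/\ forall F, sumI J1 J2 F <-> J2 (phi F), forall F, J1 (F - phi F),
      forall F, poly_in A F -> poly_in A (phi F) &
      forall g F, poly_in B g -> phi (g * F) = g * phi F].
Proof.
have [idJ2 J2c] := J2B; have [idJ1 _] := J1A.
have [phi [phiJ phi0 phiD phiA phiM]] := block_projection J1A.
have phiMB g F : poly_in B g -> phi (g * F) = g * phi F.
  by move=> gB; apply: phiM; apply: poly_in_sub gB; apply: disjoint_subC.
have phi00 : phi 0 = 0 by apply: phi0; apply: ideal_0.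
have phiJ2 F : J2 F -> J2 (phi F).
  move=> JF; rewrite (bcoef_sum B (leqnn (msize F))) (big_morph _ phiD phi00).
  apply: (ideal_sum idJ2) => b _; rewrite phiMB; last exact: bcoef_in.
  by apply: (ideal_Mr idJ2); apply: J2c.
exists phi; split=> // F; split=> [[a Ja Jb] | JF].
  by rewrite -(subrK a F) phiD (phi0 a Ja) addr0; apply: phiJ2.
by exists (F - phi F); rewrite ?subKr.
Qed.

(** A polynomial in the variables of [B] acts on the free module [S/J1] over these
 variables, so regularity modulo [J2] survives the base change. *)
Lemma regular_sumI g : poly_in B g -> regular J2 g -> regular (sumI J1 J2) g.
Proof.
move=> gB regg F; have [phi [phiE _ _ phiM]] := sumI_projection.
by move/phiE; rewrite phiM // => /regg /phiE.
Qed.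

(** The projection [phi u] is a nonzero polynomial in the variables of [A]; any one of its
 coefficients exhibits a nonzero multiple of [v] in [J2]. *)
Lemma sumI_mul_notin u v : poly_in A u -> poly_in B v -> ~ J1 u -> ~ J2 v ->
  ~ sumI J1 J2 (v * u).
Proof.
move=> uA vB J1u J2v; have [phi [phiE phiJ phiA phiM]] := sumI_projection.
move/phiE; rewrite phiM // => J2vc; have cA := phiA u uA.
have [c0 | nz_c] := eqVneq (phi u) 0.
  by apply: J1u; rewrite -(subr0 u) -c0.
set c := phi u in cA nz_c J2vc; set m := mlead c.
apply: J2v; have [idJ2 J2c] := J2B.
have: J2 (bcoef B m (v * c)) by apply: J2c.
rewrite bcoefM // => J2vm.
suff def_m : bcoef B m c = (c@_m)%:MP.
  rewrite (_ : v = ((c@_m)^-1)%:MP * (v * bcoef B m c)); first exact: (ideal_Ml idJ2).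
  by rewrite def_m mulrCA -mpolyCM mulVf ?mulr1 // mleadc_eq0.
move/poly_inP: cA => cA; have sABc : A \subset ~: B.
  by rewrite -disjoints_subset.
rewrite /bcoef /lin (bigD1_seq m) ?mlead_supp ?msupp_uniq //=.
rewrite big_seq_cond big1 ?addr0.
  have mA := cA m (mlead_supp nz_c).
  by rewrite (rst_sub sABc mA) eqxx (rst_disjoint disAB mA) mpolyX0 -mul_mpolyC mulr1.
move=> b /andP [/cA bA neq_b].
by rewrite (rst_sub sABc bA) (negPf neq_b) scaler0.
Qed.

End TwoBlocks.

Lemma regseq_sumI A B J1 J2 s : [disjoint A & B] -> generated_in A J1 ->
  generated_in B J2 -> (forall f, f \in s -> poly_in B f) -> regseq J2 s ->
  regseq (sumI J1 J2) s /\ adds (sumI J1 J2) s = sumI J1 (adds J2 s).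
Proof.
move=> disAB J1A; elim: s J2 => //= f s IHs J2 J2B sB [regf regs].
have fB : poly_in B f by apply: sB; rewrite mem_head.
have sB' g : g \in s -> poly_in B g by move=> sg; apply: sB; rewrite in_cons sg orbT.
have [regs' def_adds] := IHs _ (generated_in_addI J2B fB) sB' regs.
by rewrite -sumI_addI_r; split=> //; split=> //; apply: (regular_sumI disAB J1A J2B).
Qed.

(** Concatenating maximal regular sequences of the two factors gives a maximal one of
 the tensor product, whose socle contains the product of the two socle elements. *)
Lemma has_depth_tensor A B J1 J2 d1 d2 : [disjoint A & B] ->
  generated_in A J1 -> generated_in B J2 ->
  has_depth (aug A) J1 d1 -> has_depth (aug B) J2 d2 ->
  has_depth (aug (A :|: B)) (sumI J1 J2) (d1 + d2)%N.
Proof.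
move=> disAB J1A J2B [s [As regs szs socs]] [t [Bt regt szt soct]].
have sA f : f \in s -> poly_in A f by case/As.
have tB f : f \in t -> poly_in B f by case/Bt.
have disBA : [disjoint B & A] by rewrite disjoint_sym.
have J1sA := generated_in_adds J1A sA; have J2tB := generated_in_adds J2B tB.
have [regs' def_s] := regseq_sumI disBA J2B J1A sA regs.
have [regt' def_t] := regseq_sumI disAB J1sA J2B tB regt.
exists (s ++ t); split.
- move=> e; rewrite mem_cat => /orP [/As | /Bt].
    by apply: aug_sub; apply: subsetUl.
  by apply: aug_sub; apply: subsetUr.
- by apply/regseq_cat; split; [rewrite sumIC | rewrite sumIC def_s sumIC].
- by rewrite size_cat szs szt.
rewrite adds_cat sumIC def_s sumIC def_t.
have [u [uA J1u Eu]] := socle_in J1sA socs; have [v [vB J2v Ev]] := socle_in J2tB soct.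
have [[idJ1 _] [idJ2 _]] := (J1sA, J2tB); have idJ := sumI_ideal idJ1 idJ2.
exists (v * u); first exact: (sumI_mul_notin disAB J1sA J2tB).
apply: (aug_kill idJ) => i; rewrite inE => /orP [Ai | Bi].
  rewrite mulrCA; apply: (ideal_Ml idJ); exists ('X_i * u); first by apply: Eu; apply: augX.
  by rewrite subrr; apply: ideal_0.
rewrite mulrA; apply: (ideal_Mr idJ); exists 0; first exact: ideal_0.
by rewrite subr0; apply: Ev; apply: augX.
Qed.

(** The map [psi] identifies [R/I] with the ring of polynomials in the variables of [A]
 modulo [J], over which [S/J] is free; block coefficients bring equations in [S/J] back
 to [R/I]. *)
Lemma has_depth_transport (R : comNzRingType) (psi : {rmorphism R -> S}) (E I : R -> Prop)
    A J d : generated_in A J -> (forall r, poly_in A (psi r)) ->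
  (forall F, poly_in A F -> exists r, F = psi r) ->
  (forall r, I r <-> J (psi r)) -> (forall r, E r -> aug A (psi r)) ->
  (forall F, aug A F -> exists2 r, E r & F = psi r) ->
  has_depth E I d -> has_depth (aug A) J d.
Proof.
move=> + psiA Apsi + EA AE [s [Es regs szs [u Iu Eu]]].
suff transfer J' I' : generated_in A J' -> (forall r, I' r <-> J' (psi r)) -> regseq I' s ->
    [/\ regseq J' (map psi s) & forall r, adds I' s r <-> adds J' (map psi s) (psi r)].
  move=> JA IJ; have [regs' Is] := transfer J I JA IJ regs.
  exists (map psi s); split=> //; last 1 first.
  - exists (psi u); first by move/Is.
    by move=> e /AE [r Er ->]; rewrite -rmorphM; apply/Is/Eu.
  - by move=> e /mapP [f /Es Ef ->]; apply: EA.
  - by rewrite size_map.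
elim: s J' I' {Es regs szs Iu Eu} => //= f s IHs J' I' JA IJ [regf regs].
have [idJ Jc] := JA.
have IJf r : addI I' f r <-> addI J' (psi f) (psi r).
  split=> [[a Ia] | [a Ja]].
    by exists (psi a); rewrite -rmorphM -rmorphB; apply/IJ.
  have [a' def_a] := Apsi _ (@bcoef_in K n A 0%MM a).
  exists a'; apply/IJ; rewrite rmorphB rmorphM -def_a mulrC -bcoefM //.
  rewrite -[X in X - _](bcoef_id (psiA r)).
  by rewrite -[- _]scaleN1r -linZ scaleN1r -linD mulrC; apply: Jc.
have [regs' Is] := IHs _ _ (generated_in_addI JA (psiA f)) IJf regs.
split=> //; split=> // F JF.
apply: (ideal_bcoef (A := A) idJ) => b; have [a def_a] := Apsi _ (@bcoef_in K n A b F).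
by rewrite def_a; apply/IJ/regf/IJ; rewrite rmorphM -def_a -bcoefM //; apply: Jc.
Qed.

End Tensor.

(** * Monomial ideals *)

Section MonomialIdeals.
Variables (K : fieldType) (n : nat).
Local Notation S := {mpoly K[n]}.
Implicit Types (A B : {set 'I_n}) (m a b : 'X_{1..n}) (f F G : S) (J : S -> Prop).
Implicit Types (C : pred 'X_{1..n}).

Definition mid C F : Prop := forall m, m \in msupp F -> C m.

Definition upset C : Prop := forall a m, C m -> C (a + m)%MM.

Lemma mid_ideal C : upset C -> ideal (mid C).
Proof.
move=> upC; split=> [m | f g fC gC m /msuppD_le | f g gC m /msuppM_le].
- by rewrite msupp0.
- by rewrite mem_cat => /orP [/fC | /gC].
- by case/allpairsP => -[m1 m2] [_ /gC Cm2 ->]; apply: upC.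
Qed.

Lemma midX C m : mid C ('X_[m] : S) <-> C m.
Proof.
split=> [|Cm m']; first by apply; rewrite msuppX mem_seq1.
by rewrite msuppX mem_seq1 => /eqP ->.
Qed.

Lemma mid_ind C J F : ideal J -> (forall m, C m -> J 'X_[m]) -> mid C F -> J F.
Proof.
move=> idJ JX FC; rewrite [F]mpolyE big_seq; apply: (ideal_sum idJ) => m /FC Cm.
by rewrite -mul_mpolyC; apply: (ideal_Ml idJ); apply: JX.
Qed.

Lemma eq_mid C1 C2 : C1 =1 C2 -> mid C1 = mid C2.
Proof. by move=> eqC; apply: pred_ext => F; split=> FC m /FC; rewrite eqC. Qed.

Lemma mid_sumI C1 C2 : upset C1 -> upset C2 ->
  sumI (mid C1) (mid C2) = mid (fun m => C1 m || C2 m).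
Proof.
move=> up1 up2; have id1 := mid_ideal up1; have id2 := mid_ideal up2.
apply: pred_ext => F; split.
  have upC : upset (fun m => C1 m || C2 m).
    by move=> a m /orP [/up1 -> // | /up2 ->]; rewrite orbT.
  apply: (sumI_sub (mid_ideal upC)) => G GC m /GC Cm; first by rewrite Cm.
  by rewrite Cm orbT.
apply: mid_ind => [|m /orP [C1m | C2m]]; first exact: sumI_ideal.
  by exists 'X_[m]; [apply/midX | rewrite subrr; apply: ideal_0].
by exists 0; [apply: ideal_0 | rewrite subr0; apply/midX].
Qed.

Lemma mid_addI C i : upset C ->
  addI (mid C) 'X_i = mid (fun m => C m || (m i != 0%N)).
Proof.
move=> upC; have idC := mid_ideal upC; apply: pred_ext => F; split.
  have upCi : upset (fun m => C m || (m i != 0%N)).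
    move=> a m; rewrite mnmDE addn_eq0 negb_and.
    by case/orP => [/upC -> // | ->]; rewrite !orbT.
  apply: (addI_sub (mid_ideal upCi)) => [G GC m /GC -> // |].
  by apply/midX; rewrite mnm1E eqxx orbT.
apply: mid_ind => [|m /orP [Cm | mi]]; first exact: addI_ideal.
  by apply: sub_addI; apply/midX.
exists 'X_[m - U_(i)]; rewrite -mpolyXD submK ?lep1mP // subrr.
exact: ideal_0.
Qed.

Lemma mid_colon C i : colon (mid C) 'X_i = mid (fun m => C (U_(i) + m)%MM).
Proof.
apply: pred_ext => F; split=> FC m.
  by move=> Fm; apply: FC; rewrite (perm_mem (msuppMX _ _)); apply/mapP; exists m.
by rewrite (perm_mem (msuppMX _ _)) => /mapP [m' /FC + ->].
Qed.

Lemma mid_generated_in A C : upset C -> (forall m, C m -> C (rst A m)) ->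
  generated_in A (mid C).
Proof.
move=> upC CA; split=> [|b F FC]; first exact: mid_ideal.
have idC := mid_ideal upC; rewrite /bcoef /lin big_seq.
apply: (ideal_sum idC) => m /FC Cm; rewrite -mul_mpolyC; apply: (ideal_Ml idC).
by case: ifP => _; [apply/midX; apply: CA | apply: ideal_0].
Qed.

End MonomialIdeals.

(** * Edge ideals of induced subgraphs *)

Section Graphs.
Variables (K : fieldType) (G : sgraph).
Local Notation S := {mpoly K[#|G|]}.
Implicit Types (W : {set G}) (x y v : G) (m a : 'X_{1..#|G|}).

Definition var_set W : {set 'I_#|G|} := [set i | enum_val i \in W].

Lemma mem_var_set W x : (enum_rank x \in var_set W) = (x \in W).
Proof. by rewrite inE enum_rankK. Qed.

Lemma var_setU W1 W2 : var_set (W1 :|: W2) = var_set W1 :|: var_set W2.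
Proof. by apply/setP => i; rewrite !inE. Qed.

Lemma var_set_disjoint W1 W2 : [disjoint W1 & W2] -> [disjoint var_set W1 & var_set W2].
Proof.
move=> dis; rewrite -setI_eq0; apply/eqP/setP => i; rewrite !inE.
by apply/negP => /andP [/(disjointFr dis) ->].
Qed.

Definition has_edge W m : bool :=
  [exists x in W, exists y in W,
    [&& adj x y, m (enum_rank x) != 0%N & m (enum_rank y) != 0%N]].

Definition touches W m : bool := [exists x in W, m (enum_rank x) != 0%N].

Lemma has_edgeP W m : reflect (exists x y, [/\ x \in W, y \in W, adj x y,
  m (enum_rank x) != 0%N & m (enum_rank y) != 0%N]) (has_edge W m).
Proof.
apply: (iffP idP) => [/existsP [x /andP [Wx /existsP [y /andP [Wy /and3P [xy mx my]]]]] |].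
  by exists x, y.
case=> x [y [Wx Wy xy mx my]]; apply/existsP; exists x; rewrite Wx /=.
by apply/existsP; exists y; rewrite Wy xy mx.
Qed.

Lemma touchesP W m : reflect (exists2 x, x \in W & m (enum_rank x) != 0%N) (touches W m).
Proof. exact: (iffP exists_inP) => -[x]; exists x. Qed.

Lemma mnmD_neq0 a m (i : 'I_#|G|) : m i != 0%N -> (a + m)%MM i != 0%N.
Proof. by rewrite mnmDE addn_eq0 negb_and orbC => ->. Qed.

Lemma has_edge_upset W : upset (has_edge W).
Proof.
move=> a m /has_edgeP [x [y [Wx Wy xy mx my]]]; apply/has_edgeP.
by exists x, y; split=> //; apply: mnmD_neq0.
Qed.

Lemma touches_upset W : upset (touches W).
Proof.
by move=> a m /touchesP [x Wx mx]; apply/touchesP; exists x => //; apply: mnmD_neq0.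
Qed.

Lemma rst_var_set W m x : x \in W -> rst (var_set W) m (enum_rank x) = m (enum_rank x).
Proof. by move=> Wx; rewrite rstE mem_var_set Wx. Qed.

Lemma has_edge_rst W m : has_edge W (rst (var_set W) m) = has_edge W m.
Proof.
by apply/has_edgeP/has_edgeP => -[x [y [Wx Wy xy]]]; rewrite ?rst_var_set // => mx my;
  exists x, y; rewrite ?rst_var_set.
Qed.

Lemma touches_rst W m : touches W (rst (var_set W) m) = touches W m.
Proof.
by apply/touchesP/touchesP => -[x Wx]; rewrite ?rst_var_set // => mx; exists x;
  rewrite ?rst_var_set.
Qed.

Lemma edges_generated_in W : generated_in (var_set W) (mid (K := K) (has_edge W)).
Proof. by apply: mid_generated_in => [|m]; [apply: has_edge_upset | rewrite has_edge_rst]. Qed.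

Lemma touches_generated_in W : generated_in (var_set W) (mid (K := K) (touches W)).
Proof. by apply: mid_generated_in => [|m]; [apply: touches_upset | rewrite touches_rst]. Qed.

Definition no_edges W1 W2 : Prop := forall x y, x \in W1 -> y \in W2 -> ~~ adj x y.

Lemma has_edgeU W1 W2 m : no_edges W1 W2 ->
  has_edge (W1 :|: W2) m = has_edge W1 m || has_edge W2 m.
Proof.
move=> noW; apply/has_edgeP/orP.
  case=> x [y []]; rewrite !inE => /orP [] Wx /orP [] Wy xy mx my.
  - by left; apply/has_edgeP; exists x, y.
  - by case/negP: (noW x y Wx Wy).
  - by case/negP: (noW y x Wy Wx); rewrite adj_sym.
  - by right; apply/has_edgeP; exists x, y.
by case=> /has_edgeP [x [y [Wx Wy xy mx my]]]; exists x, y; rewrite !inE Wx Wy ?orbT.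
Qed.

Definition link W v : {set G} := [set x in W | adj v x].

(** Multiplying by [v] turns each neighbour of [v] into a generator. *)
Lemma has_edge_mul W v m : v \in W ->
  has_edge W (U_(enum_rank v) + m)%MM = has_edge ((W :\ v) :\: link W v) m || touches (link W v) m.
Proof.
move=> Wv; apply/idP/orP; last first.
  case=> [/has_edgeP [x [y [Wx Wy xy mx my]]] | /touchesP [x]].
    apply/has_edgeP; exists x, y; move: Wx Wy; rewrite !inE.
    case/andP => _ /andP [_ ->]; case/andP => _ /andP [_ ->].
    by split=> //; apply: mnmD_neq0.
  rewrite inE => /andP [Wx vx] mx; apply/has_edgeP; exists v, x; split=> //.
    by rewrite mnmDE mnm1E eqxx.
  exact: mnmD_neq0.
have mulE z : v != z -> (U_(enum_rank v) + m)%MM (enum_rank z) = m (enum_rank z).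
  by rewrite mnmDE mnm1E (inj_eq enum_rank_inj) => /negPf ->.
have touchesR z : z \in W -> adj v z -> m (enum_rank z) != 0%N -> touches (link W v) m.
  by move=> Wz vz mz; apply/touchesP; exists z => //; rewrite inE Wz.
case/has_edgeP => x [y [Wx Wy xy]].
have [eq_vx | neq_vx] := eqVneq v x.
  have neq_vy : v != y by apply: contraTneq xy => <-; rewrite eq_vx adj_irr.
  by rewrite (mulE y) // => _ my; right; apply: (touchesR y); rewrite // eq_vx.
have [eq_vy | neq_vy] := eqVneq v y.
  by rewrite (mulE x) // => mx _; right; apply: (touchesR x); rewrite // eq_vy adj_sym.
rewrite !mulE // => mx my.
have [vx | vx] := boolP (adj v x); first by right; apply: (touchesR x).
have [vy | vy] := boolP (adj v y); first by right; apply: (touchesR y).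
left; apply/has_edgeP; exists x, y; split=> //.
  by rewrite !inE Wx vx eq_sym neq_vx.
by rewrite !inE Wy vy eq_sym neq_vy.
Qed.

Lemma has_edge_del W v m : v \in W ->
  has_edge W m || (m (enum_rank v) != 0%N) = has_edge (W :\ v) m || touches [set v] m.
Proof.
move=> Wv; have touches1 : touches [set v] m = (m (enum_rank v) != 0%N).
  apply/touchesP/idP => [[x /set1P -> //] | mv].
  by exists v => //; apply: set11.
rewrite touches1; have [mv | mv] := boolP (m (enum_rank v) != 0%N); rewrite ?orbT ?orbF //.
apply/has_edgeP/has_edgeP => -[x [y [Wx Wy xy mx my]]]; exists x, y; split=> //.
- by rewrite !inE Wx andbT; apply: contraNneq mv => <-.
- by rewrite !inE Wy andbT; apply: contraNneq mv => <-.
- by move: Wx; rewrite !inE => /andP [].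
- by move: Wy; rewrite !inE => /andP [].
Qed.

Definition graph_depth W d : Prop := has_depth (aug (var_set W)) (mid (K := K) (has_edge W)) d.

Lemma graph_depth_disjoint W1 W2 d1 d2 : [disjoint W1 & W2] -> no_edges W1 W2 ->
  graph_depth W1 d1 -> graph_depth W2 d2 -> graph_depth (W1 :|: W2) (d1 + d2).
Proof.
move=> dis noW D1 D2; rewrite /graph_depth (eq_mid K (fun m => has_edgeU m noW)).
rewrite -mid_sumI; try exact: has_edge_upset.
rewrite var_setU; apply: has_depth_tensor D1 D2; try exact: edges_generated_in.
exact: var_set_disjoint.
Qed.

(** The second factor of the tensor product is the field itself, of depth [0]. *)
Lemma graph_depth_kill W1 W2 d : [disjoint W1 & W2] -> graph_depth W1 d ->
  has_depth (aug (var_set (W1 :|: W2)))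
    (mid (K := K) (fun m => has_edge W1 m || touches W2 m)) d.
Proof.
move=> dis D1; rewrite -mid_sumI; [|exact: has_edge_upset|exact: touches_upset].
rewrite var_setU -[d]addn0; apply: has_depth_tensor D1 _.
- exact: var_set_disjoint.
- exact: edges_generated_in.
- exact: touches_generated_in.
exists [::]; split=> //=; have idJ := mid_ideal K (@touches_upset W2).
exists 1; first by rewrite -mpolyX0 => /midX /touchesP [x _]; rewrite mnm0E.
apply: (aug_kill idJ) => i; rewrite inE mulr1 => Wi; apply/midX/touchesP.
by exists (enum_val i); rewrite // enum_valK mnm1E eqxx.
Qed.

Lemma no_edge_set0 W m : (forall x y, x \in W -> y \in W -> ~~ adj x y) ->
  has_edge W m = false.
Proof.
move=> noW; apply/has_edgeP => -[x [y [Wx Wy xy _ _]]].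
by case/negP: (noW x y Wx Wy).
Qed.

Lemma graph_depth0 : graph_depth set0 0.
Proof.
have idJ := mid_ideal K (@has_edge_upset set0).
exists [::]; split=> //=; exists 1.
  by rewrite -mpolyX0 => /midX; rewrite no_edge_set0 // => x y; rewrite inE.
by apply: (aug_kill idJ) => i; rewrite !inE.
Qed.

Lemma graph_depth1 v : graph_depth [set v] 1.
Proof.
have noE m : has_edge [set v] m = false.
  by apply: no_edge_set0 => x y /set1P -> /set1P ->; rewrite adj_irr.
have idJ := mid_ideal K (@has_edge_upset [set v]).
have mid0 F : mid (K := K) (has_edge [set v]) F -> F = 0.
  move=> FC; apply: msuppnil0; case def_F: (msupp F) => [//|m s].
  by have := FC m; rewrite def_F mem_head noE => /(_ isT).
exists [:: 'X_(enum_rank v)]; split=> //=.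
- move=> e; rewrite mem_seq1 => /eqP ->; apply: augX.
  by rewrite mem_var_set set11.
- split=> // F /mid0 /eqP; rewrite mulf_eq0 => /orP [| /eqP ->]; last exact: ideal_0.
  by rewrite -msupp_eq0 msuppX.
exists 1.
  rewrite mid_addI; last exact: has_edge_upset.
  by rewrite -mpolyX0 => /midX; rewrite noE mnm0E.
apply: (aug_kill (addI_ideal _ idJ)) => i; rewrite !inE mulr1 => /eqP def_v.
by rewrite -(enum_valK i) def_v; apply: mem_addI.
Qed.

(** Deleting [v] versus inverting it: [v] is a free variable in [S/(I : v)], where its
 neighbours vanish. *)
Lemma graph_depth_vertex W v d d' : v \in W ->
  graph_depth ((W :\ v) :\: link W v) d -> graph_depth (W :\ v) d' -> (d < d')%N ->
  graph_depth W d.+1.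
Proof.
move=> Wv D D' lt_dd'; set U := (W :\ v) :\: link W v in D *.
have idW := mid_ideal K (@has_edge_upset W).
have UvW : (U :|: [set v]) :|: link W v = W.
  apply/setP => x; rewrite !inE; have [-> | /=] := eqVneq x v; first by rewrite Wv orbT.
  by rewrite orbF; case: (x \in W); case: (adj v x).
have sUv x : x \in U -> x != v /\ ~~ adj v x.
  by rewrite !inE => /and3P [+ + Wx]; rewrite Wx.
have disUv : [disjoint U & [set v]].
  by rewrite disjoint_sym disjoints1; apply/negP => /sUv []; rewrite eqxx.
apply: (has_depth_colon (@mpoly_noetherian K _) (@subrng_aug K _ _) idW (x := 'X_(enum_rank v))).
  rewrite mid_colon (eq_mid K (fun m => has_edge_mul m Wv)) -/U.
  have Uv_edge m : has_edge (U :|: [set v]) m = has_edge U m.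
    rewrite has_edgeU; last first.
      by move=> x y /sUv [_ vx] /set1P ->; rewrite adj_sym.
    rewrite [has_edge [set v] m]no_edge_set0 ?orbF //.
    by move=> x y /set1P -> /set1P ->; rewrite adj_irr.
  rewrite -(eq_mid K (fun m => congr1 (fun b => b || touches (link W v) m) (Uv_edge m))).
  rewrite -{1}UvW; apply: graph_depth_kill.
    rewrite -setI_eq0; apply/eqP/setP => x.
    rewrite in_setI in_setU in_set0 in_set1 [x \in link W v]inE.
    apply/negbTE/negP => /andP [/orP [/sUv [_ /negPf ->] | /eqP ->]].
      by rewrite andbF.
    by rewrite adj_irr andbF.
  rewrite -addn1; apply: graph_depth_disjoint => //; last exact: graph_depth1.
  by move=> x y /sUv [_ vx] /set1P ->; rewrite adj_sym.
rewrite mid_addI; last exact: has_edge_upset.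
rewrite (eq_mid K (fun m => has_edge_del m Wv)).
apply: (has_depth_ge _ lt_dd'); rewrite -{1}(setD1K Wv) setUC.
by apply: graph_depth_kill => //; rewrite disjoint_sym disjoints1 !inE eqxx.
Qed.

End Graphs.

(** * Stanley decompositions as partitions of monomials into cones *)

Section Cones.
Variable n : nat.
Implicit Types (A B : {set 'I_n}) (m a b : 'X_{1..n}) (C : pred 'X_{1..n}).

Definition cone : Type := ('X_{1..n} * {set 'I_n})%type.
Implicit Types (c : cone) (l : seq cone).

(** [c] stands for the monomials [c.1 t] with [t] a monomial in the variables [c.2]. *)
Definition in_cone m c : bool :=
  [forall i, if i \in c.2 then (c.1 i <= m i)%N else m i == c.1 i].

Lemma in_coneP m c : reflect
  (forall i, if i \in c.2 then (c.1 i <= m i)%N else m i == c.1 i) (in_cone m c).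
Proof. exact: forallP. Qed.

(** The combinatorial form of a Stanley decomposition. One equation on the number of cones
 through [m] says that the cones avoid [C], cover its complement and are disjoint. *)
Definition cone_partition A C l : Prop :=
  (forall c, c \in l -> rst A c.1 = c.1 /\ c.2 \subset A) /\
  forall m, rst A m = m -> count (in_cone m) l = ~~ C m.

Definition sdepth_ge A C d : Prop :=
  exists2 l, cone_partition A C l & forall c, c \in l -> (d <= #|c.2|)%N.

Lemma sdepth_ge_le A C d k : sdepth_ge A C d -> (k <= d)%N -> sdepth_ge A C k.
Proof.
by move=> [l parl led] le_kd; exists l => // c /led; apply: leq_trans.
Qed.

Lemma eq_sdepth_ge A C1 C2 d : C1 =1 C2 -> sdepth_ge A C1 d -> sdepth_ge A C2 d.
Proof.
move=> eqC [l [lA lC] led]; exists l => //; split=> // m /lC.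
by rewrite eqC.
Qed.

Definition cone_mul c1 c2 : cone := ((c1.1 + c2.1)%MM, c1.2 :|: c2.2).

Lemma in_cone_mul A B m c1 c2 : [disjoint A & B] ->
  rst A c1.1 = c1.1 -> c1.2 \subset A -> rst B c2.1 = c2.1 -> c2.2 \subset B ->
  rst (A :|: B) m = m ->
  in_cone m (cone_mul c1 c2) = in_cone (rst A m) c1 && in_cone (rst B m) c2.
Proof.
move=> disAB /rst_idP c1A /subsetP X1A /rst_idP c2B /subsetP X2B /rst_idP mAB.
have notA i : i \notin A -> (i \in c1.2 = false) * (c1.1 i = 0%N).
  by move=> Ai; rewrite c1A // (contraNF (X1A i)).
have notB i : i \notin B -> (i \in c2.2 = false) * (c2.1 i = 0%N).
  by move=> Bi; rewrite c2B // (contraNF (X2B i)).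
have AnB i : i \in A -> i \notin B by move=> Ai; rewrite (disjointFr disAB).
have BnA i : i \in B -> i \notin A by move=> Bi; rewrite (disjointFl disAB).
apply/in_coneP/andP => [cm | [/in_coneP cm1 /in_coneP cm2] i].
  split; apply/in_coneP => i; have := cm i; rewrite /= inE mnmDE rstE.
    have [Ai | nAi] := boolP (i \in A); last by rewrite !notA.
    by rewrite !notB ?AnB // orbF addn0.
  have [Bi | nBi] := boolP (i \in B); last by rewrite !notB.
  by rewrite !notA ?BnA.
rewrite /= inE mnmDE; have := cm1 i; have := cm2 i; rewrite !rstE.
have [Ai | nAi] := boolP (i \in A).
  by rewrite (negPf (AnB i Ai)) !notB ?AnB // orbF addn0.
have [Bi | nBi] := boolP (i \in B); first by rewrite !notA.
by rewrite !notA // !notB // mAB // inE negb_or nAi.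
Qed.

Lemma count_allpairs (T1 T2 : eqType) (T : Type) (f : T1 -> T2 -> T) (p : pred T)
    (p1 : pred T1) (p2 : pred T2) (s : seq T1) (t : seq T2) :
  (forall x y, x \in s -> y \in t -> p (f x y) = p1 x && p2 y) ->
  count p [seq f x y | x <- s, y <- t] = (count p1 s * count p2 t)%N.
Proof.
elim: s => //= x s IHs pE; rewrite count_cat IHs => [|z y sz ty]; last first.
  by apply: pE; rewrite // in_cons sz orbT.
rewrite mulnDl; congr (_ + _)%N.
rewrite count_map (eq_in_count (a2 := fun y => p1 x && p2 y)) => [|y ty]; last first.
  by rewrite /= pE ?mem_head.
by case: (p1 x); rewrite ?mul1n // mul0n count_pred0.
Qed.

Lemma sdepth_ge_tensor A B C1 C2 d1 d2 : [disjoint A & B] ->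
  (forall m, C1 (rst A m) = C1 m) -> (forall m, C2 (rst B m) = C2 m) ->
  sdepth_ge A C1 d1 -> sdepth_ge B C2 d2 ->
  sdepth_ge (A :|: B) (fun m => C1 m || C2 m) (d1 + d2)%N.
Proof.
move=> disAB C1A C2B [l1 [l1A l1C] l1d] [l2 [l2B l2C] l2d].
exists [seq cone_mul c1 c2 | c1 <- l1, c2 <- l2]; first split.
- move=> c /allpairsP [[c1 c2] [/= /l1A [c1A X1A] /l2B [c2B X2B] ->]] /=.
  split; last exact: setUSS.
  by rewrite rstD (rst_sub (subsetUl A B) c1A) (rst_sub (subsetUr A B) c2B).
- move=> m mAB; rewrite (count_allpairs (p1 := in_cone (rst A m)) (p2 := in_cone (rst B m))).
    by rewrite l1C ?l2C ?rst_id // C1A C2B; case: (C1 m); case: (C2 m).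
  move=> c1 c2 /l1A [c1A X1A] /l2B [c2B X2B].
  exact: (in_cone_mul disAB).
move=> c /allpairsP [[c1 c2] [/= l1c l2c ->]] /=.
have [[_ X1A] [_ X2B]] := (l1A _ l1c, l2B _ l2c).
rewrite cardsU disjoint_setI0 ?cards0 ?subn0; first exact: leq_add (l1d _ l1c) (l2d _ l2c).
exact: disjointWl X1A (disjointWr X2B disAB).
Qed.

(** The upper bound at a prime: a cone containing a high power of the product of a set
 [F] of variables must be free on [F], and on nothing else when [F] is maximal. *)
Lemma sdepth_ge_facet C (F : {set 'I_n}) d :
  (forall m, rst F m = m -> ~~ C m) ->
  (forall m i, i \notin F -> (forall j, j \in F -> m j != 0%N) -> m i != 0%N -> C m) ->
  sdepth_ge setT C d -> (d <= #|F|)%N.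
Proof.
move=> Ffree Fmax [l [_ lC] ld].
pose k := (\sum_(c <- l) mdeg c.1).+1.
pose m : 'X_{1..n} := [multinom if i \in F then k else 0%N | i < n].
have mF i : i \in F -> m i = k by move=> Fi; rewrite mnmE Fi.
have rstT (a : 'X_{1..n}) : rst setT a = a by apply/rst_idP => i; rewrite inE.
have mFm : rst F m = m by apply/rst_idP => i; rewrite mnmE => /negPf ->.
have: has (in_cone m) l by rewrite has_count lC ?rstT // Ffree.
case/hasP => c lc /in_coneP cm; apply: leq_trans (ld c lc) _.
apply/subset_leq_card/subsetP => i Xi; apply: contraT => nFi.
have FX j : j \in F -> j \in c.2.
  move=> Fj; apply: contraT => nXj; have := cm j; rewrite (negPf nXj) mF // => /eqP eq_k.
  suff: (k <= \sum_(c <- l) mdeg c.1)%N by rewrite ltnn.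
  rewrite eq_k (perm_big _ (perm_to_rem lc)) big_cons /=.
  by rewrite mdegE (bigD1 j) //= -!addnA leq_addr.
have: has (in_cone (U_(i) + m)%MM) l.
  apply/hasP; exists c => //; apply/in_coneP => j; have := cm j; rewrite mnmDE mnm1E.
  case: ifPn => [Xj le_j | nXj]; first exact: leq_trans le_j (leq_addl _ _).
  by case: (eqVneq i j) nXj => [<- | //]; rewrite Xi.
rewrite has_count lC ?rstT // (Fmax _ i) //.
  by move=> j Fj; rewrite mnmDE mF // addnS.
by rewrite mnmDE mnm1E eqxx.
Qed.

End Cones.

Section GraphSdepth.
Variable G : sgraph.
Implicit Types (W : {set G}) (x y v : G) (m a : 'X_{1..#|G|}).

Definition graph_sdepth W d : Prop := sdepth_ge (var_set W) (has_edge W) d.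

Lemma graph_sdepth_disjoint W1 W2 d1 d2 : [disjoint W1 & W2] -> no_edges W1 W2 ->
  graph_sdepth W1 d1 -> graph_sdepth W2 d2 -> graph_sdepth (W1 :|: W2) (d1 + d2).
Proof.
move=> dis noW D1 D2; apply: eq_sdepth_ge (fun m => esym (has_edgeU m noW)) _.
rewrite var_setU; apply: sdepth_ge_tensor D1 D2 => [|m|m]; try exact: has_edge_rst.
exact: var_set_disjoint.
Qed.

Lemma graph_sdepth0 : graph_sdepth set0 0.
Proof.
exists [:: (0%MM, set0)] => //; split=> [c | m].
  by rewrite mem_seq1 => /eqP -> /=; rewrite rst0 sub0set.
have -> : var_set set0 = set0 :> {set 'I_#|G|} by apply/setP => i; rewrite !inE.
move=> m0; rewrite no_edge_set0 => [|x y]; last by rewrite inE.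
rewrite /= addn0; suff -> : in_cone m (0%MM, set0) by [].
apply/in_coneP => i /=; rewrite inE mnm0E.
by apply/eqP; move/rst_idP: m0; apply; rewrite inE.
Qed.

Lemma graph_sdepth1 v : graph_sdepth [set v] 1.
Proof.
exists [:: (0%MM, var_set [set v])]; first split.
- by move=> c; rewrite mem_seq1 => /eqP -> /=; rewrite rst0.
- move=> m mv; rewrite no_edge_set0 => [|x y /set1P -> /set1P ->]; last by rewrite adj_irr.
  rewrite /= addn0; suff -> : in_cone m (0%MM, var_set [set v]) by [].
  apply/in_coneP => i /=; rewrite mnm0E; case: ifPn => // nvi.
  by apply/eqP; move/rst_idP: mv; apply.
move=> c; rewrite mem_seq1 => /eqP -> /=.
by rewrite card_gt0; apply/set0Pn; exists (enum_rank v); rewrite mem_var_set set11.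
Qed.

(** The monomials divisible by [v] are [v] times the monomials outside [I : v]. *)
Lemma graph_sdepth_vertex W v d d' : v \in W ->
  graph_sdepth ((W :\ v) :\: link W v) d -> graph_sdepth (W :\ v) d' -> (d < d')%N ->
  graph_sdepth W d.+1.
Proof.
move=> Wv; set U := (W :\ v) :\: link W v; set i := enum_rank v.
move=> [l1 [l1U l1C] l1d] [l2 [l2W l2C] l2d] lt_dd'.
have sUW : var_set U \subset var_set W.
  by apply/subsetP => j; rewrite !inE => /andP [_ /andP []].
have sW'W : var_set (W :\ v) \subset var_set W.
  by apply/subsetP => j; rewrite !inE => /andP [].
have nUi : i \notin var_set U by rewrite mem_var_set !inE eqxx andbF.
have nWi : i \notin var_set (W :\ v) by rewrite mem_var_set !inE eqxx.
have Wi : i \in var_set W by rewrite mem_var_set.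
exists ([seq ((U_(i) + c.1)%MM, i |: c.2) | c <- l1] ++ l2); first split.
- move=> c; rewrite mem_cat => /orP [/mapP [c1 /l1U [c1U X1U] ->] | /l2W [c2W X2W]] /=.
    rewrite rstU // (rst_sub sUW c1U); split=> //.
    by rewrite subUset sub1set Wi; apply: subset_trans sUW.
  by rewrite (rst_sub sW'W c2W); split=> //; apply: subset_trans sW'W.
- move=> m mW; rewrite count_cat count_map.
  have [mi0 | mi] := eqVneq (m i) 0%N.
    rewrite (eq_count (a2 := pred0)) => [|c]; last first.
      apply/negbTE/negP => /in_coneP /(_ i) /=.
      by rewrite setU11 mnmDE mnm1E eqxx mi0.
    have mW' : rst (var_set (W :\ v)) m = m.
      apply/rst_idP => j; have [-> // | neq_ji] := eqVneq j i.
      move=> nWj; move/rst_idP: mW; apply; apply: contra nWj; rewrite !inE => ->.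
      by rewrite andbT; apply: contra neq_ji => /eqP def_v; rewrite /i -def_v enum_valK.
    rewrite count_pred0 l2C //; have := has_edge_del m Wv.
    rewrite -/i mi0 orbF => ->; suff -> : touches [set v] m = false by rewrite orbF.
    by apply/touchesP => -[x /set1P ->]; rewrite -/i mi0.
  rewrite [count _ l2](eq_in_count (a2 := pred0)) => [|c /l2W [/rst_idP c2W X2W]]; last first.
    apply/negbTE/negP => /in_coneP /(_ i).
    by rewrite (contraNF (subsetP X2W i) nWi) c2W // (negPf mi).
  rewrite count_pred0 addn0.
  have -> : has_edge W m = has_edge U m || touches (link W v) m.
    have def_m : (U_(i) + (m - U_(i)))%MM = m by rewrite addmC submK // lep1mP.
    have eq_m x : x != v -> (m - U_(i))%MM (enum_rank x) = m (enum_rank x).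
      by rewrite mnmBE mnm1E (inj_eq enum_rank_inj) eq_sym => /negPf ->; rewrite subn0.
    have eq_rst (V : {set G}) : v \notin V ->
        rst (var_set V) (m - U_(i)) = rst (var_set V) m.
      move=> nVv; apply/mnmP => j; rewrite !rstE; case: ifP => //; rewrite inE => Vj.
      rewrite -[j]enum_valK eq_m //; apply: contraNneq nVv => <- //.
    rewrite -{1}def_m has_edge_mul // -/U -has_edge_rst -[touches _ _]touches_rst.
    by rewrite !eq_rst ?has_edge_rst ?touches_rst // !inE ?adj_irr ?eqxx ?andbF.
  have mU : rst (var_set U) (rst (var_set U) m) = rst (var_set U) m by rewrite rst_id.
  have [/touchesP [x] | /touchesP nlink] := boolP (touches (link W v) m).
    rewrite orbT inE => /andP [Wx vx] mx.
    rewrite (eq_in_count (a2 := pred0)) ?count_pred0 // => c /l1U [/rst_idP c1U X1U].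
    have nUx : enum_rank x \notin var_set U by rewrite mem_var_set !inE Wx vx.
    have neq_vx : v != x by apply: contraTneq vx => <-; rewrite adj_irr.
    apply/negbTE/negP => /in_coneP /(_ (enum_rank x)) /=.
    rewrite !inE (inj_eq enum_rank_inj) eq_sym (negPf neq_vx) /=.
    rewrite (contraNF (subsetP X1U _) nUx) mnmDE mnm1E (inj_eq enum_rank_inj) (negPf neq_vx).
    by rewrite c1U // (negPf mx).
  rewrite orbF -has_edge_rst -(l1C _ mU).
  apply: eq_in_count => c /l1U [/rst_idP c1U /subsetP X1U].
  apply/in_coneP/in_coneP => /= cm j; have := cm j; rewrite /= !inE mnmDE mnm1E rstE.
    have [Uj | nUj] := boolP (j \in var_set U); last first.
      by rewrite (contraNF (X1U j) nUj) c1U.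
    have neq_ij : (i == j) = false by apply: contraNF nUi => /eqP ->.
    by rewrite eq_sym neq_ij.
  have [<- | neq_ij] := eqVneq i j.
    by rewrite /= add1n c1U // lt0n.
  rewrite /= add0n.
  have [Uj | nUj] := boolP (j \in var_set U) => //.
  rewrite (contraNF (X1U j) nUj) c1U // => _.
  have [Wj | nWj] := boolP (j \in var_set W); last by apply/eqP; move/rst_idP: mW; apply.
  apply: contraT => mj; case: nlink; exists (enum_val j); last by rewrite enum_valK.
  move: nUj Wj; rewrite !inE => + Wj; rewrite Wj /= andbT.
  suff -> : enum_val j != v by rewrite andbT negbK.
  by apply: contraNneq neq_ij => def_v; rewrite /i -def_v enum_valK.
move=> c; rewrite mem_cat => /orP [/mapP [c1 l1c ->] | /l2d]; last exact: leq_trans.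
have [_ X1U] := l1U c1 l1c; rewrite /= cardsU1 (contra (subsetP X1U i) nUi) add1n ltnS.
exact: l1d.
Qed.

(** By induction on [W]: the trivial bound [0] for [I : v] is enough in the rule for [v]. *)
Lemma graph_sdepth_gt0 W : W != set0 -> graph_sdepth W 1.
Proof.
have any V : graph_sdepth V 0 /\ (V != set0 -> graph_sdepth V 1).
  have [k] := ubnP #|V|; elim: k V => // k IHk V ltVk.
  have [-> | nz_V] := eqVneq V set0.
    by split=> //; apply: graph_sdepth0.
  suff V1 : graph_sdepth V 1 by split=> [|_]; [apply: sdepth_ge_le V1 _ | exact: V1].
  have [v Vv] := set0Pn _ nz_V.
  have lt1 : (#|V :\ v| < k)%N by rewrite (cardsD1 v V) Vv in ltVk.
  have [V'0 | nz_V'] := eqVneq (V :\ v) set0.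
    by rewrite -(setD1K Vv) V'0 setU0; apply: graph_sdepth1.
  have lt2 : (#|(V :\ v) :\: link V v| < k)%N.
    by apply: leq_ltn_trans lt1; apply: subset_leq_card; apply: subsetDl.
  have [_ /(_ nz_V') D'] := IHk _ lt1; have [D _] := IHk _ lt2.
  exact: graph_sdepth_vertex D D' _.
by case: (any W).
Qed.

End GraphSdepth.

(** * Corona of a path *)

(** The rules shared by the depth and the Stanley depth of induced subgraphs; [D W d] is
 exact for the former and a lower bound for the latter. *)
Definition depth_rules (G : sgraph) (D : {set G} -> nat -> Prop) : Prop :=
  [/\ D set0 0%N, forall v, D [set v] 1%N,
      forall (W1 W2 : {set G}) d1 d2, [disjoint W1 & W2] -> no_edges W1 W2 ->
        D W1 d1 -> D W2 d2 -> D (W1 :|: W2) (d1 + d2)%N &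
      forall (W : {set G}) v d d', v \in W -> D ((W :\ v) :\: link W v) d -> D (W :\ v) d' ->
        (d < d')%N -> D W d.+1].

Lemma depth_rules_discrete (G : sgraph) (D : {set G} -> nat -> Prop) (W : {set G}) :
  depth_rules D -> no_edges W W -> D W #|W|.
Proof.
move=> [D0 D1 DU _]; have [k] := ubnP #|W|; elim: k W => // k IHk W ltWk noW.
have [-> | [v Wv]] := set_0Vmem W; first by rewrite cards0.
rewrite (cardsD1 v W) Wv -{1}(setD1K Wv); apply: DU => //.
- by rewrite disjoints1 !inE eqxx.
- by move=> x y /set1P -> /setD1P [_ Wy]; apply: noW.
apply: IHk; first by rewrite (cardsD1 v W) Wv in ltWk.
by move=> x y /setD1P [_ Wx] /setD1P [_ Wy]; apply: noW.
Qed.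

Section PathCorona.
Variables (n : nat) (H : sgraph).
Local Notation G := (corona (path_graph n) H).
Implicit Types (i j : 'I_n) (u v : G).

Definition position v : nat := match v with inl i => i | inr (i, _) => i end.
Definition initial k : {set G} := [set v | (position v < k)%N].
Definition copy i : {set G} := [set inr (i, h) | h : H].

Lemma mem_copy i v : (v \in copy i) = if v is inr (j, _) then j == i else false.
Proof.
apply/imsetP/idP => [[h _ ->] /= | ]; first exact: eqxx.
by case: v => // -[j h] /eqP ->; exists h.
Qed.

Variables (D : {set G} -> nat -> Prop) (t : nat).
Hypotheses (rulesD : depth_rules D) (copyD : forall i, D (copy i) t) (t_gt0 : (0 < t)%N).

Definition path_depth k : nat := (uphalf k + k./2 * t)%N.

Lemma path_depthSS k : path_depth k.+2 = (path_depth k + t).+1.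
Proof. by rewrite /path_depth /= mulSn; lia. Qed.

Lemma path_depth_lt k : (path_depth k < path_depth k.+1)%N.
Proof.
have eq_up : uphalf k.+1 = k./2.+1 by [].
have eq_half : k.+1./2 = uphalf k by [].
rewrite /path_depth eq_up eq_half uphalf_half; case: (odd k) => /=; nia.
Qed.

(** Here [v] is the last path vertex. Deleting it splits off its copy of [H]. Inverting
 it removes that copy and the previous path vertex, which splits off the previous copy. *)
Lemma initial_depth k : (k <= n)%N -> D (initial k) (path_depth k).
Proof.
have [D0 _ DU Dv] := rulesD.
have addcopy j : D (initial j) (path_depth j) -> D (initial j :|: copy j) (path_depth j + t).
  move=> Dj; apply: DU => //.
    rewrite disjoints_subset; apply/subsetP => v; rewrite !inE mem_copy.
    by case: v => // -[i h] /= lt_ij; apply: contraL lt_ij => /eqP ->; rewrite ltnn.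
  move=> u v; rewrite inE mem_copy; case: v => // -[i h] + /eqP ->.
  by case: u => [u | [u h']] /= lt_uj; rewrite -?negb_and; case: eqP lt_uj => // ->; rewrite ltnn.
suff two_steps : (k <= n)%N -> D (initial k) (path_depth k) /\
    forall l, k = l.+1 -> D (initial l) (path_depth l) by case/two_steps.
elim: k => [_ | k IHk lt_kn].
  have -> : initial 0 = set0 by apply/setP => v; rewrite !inE.
  by split.
have [Dk Dk'] := IHk (ltnW lt_kn); split=> [|l [<-] //].
pose i := Ordinal lt_kn; pose v : G := inl i.
have initial_v : initial k.+1 :\ v = initial k :|: copy i.
  apply/setP => u; rewrite !inE mem_copy /= ltnS leq_eqVlt.
  case: u => [j | [j h]] /=; last by rewrite orbC.
  have -> : (inl j == v) = (j == k :> nat).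
    by apply/eqP/eqP => [[->] // | def_j]; congr inl; apply: val_inj.
  by rewrite orbF; case: ltngtP.
have DkS := addcopy i Dk.
have v_in : v \in initial k.+1 by rewrite inE /=.
case: k {IHk} => [|k] in lt_kn Dk Dk' i v initial_v DkS v_in *.
  have link_v : (initial 1 :\ v) :\: link (initial 1) v = set0.
    apply/setP => u; rewrite initial_v !inE mem_copy.
    case: u => [j | [j h]] /=; rewrite ltn0 ?andbF // (eq_sym j).
    by case: eqVneq => [<- | _]; rewrite ?andbF.
  have := Dv _ v 0%N (path_depth 0 + t)%N v_in; rewrite link_v initial_v.
  exact.
have Dj := Dk' k erefl; have lt_kn' : (k < n)%N := ltnW lt_kn.
pose j := Ordinal lt_kn'; have DjS := addcopy j Dj.
have link_v : (initial k.+2 :\ v) :\: link (initial k.+2) v = initial j :|: copy j.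
  apply/setP => u; rewrite initial_v !inE !mem_copy /=.
  case: u => [a | [a h]] /=; rewrite /path_adj /=; first by lia.
  by rewrite -!val_eqE /=; lia.
rewrite path_depthSS.
have := Dv _ v (path_depth k + t)%N (path_depth k.+1 + t)%N v_in; rewrite link_v initial_v.
by apply; rewrite // ltn_add2r; apply: path_depth_lt.
Qed.


End PathCorona.

(** * Embedding a graph into a larger one *)

Lemma card_var_set (G : sgraph) (W : {set G}) : #|var_set W| = #|W|.
Proof.
rewrite -(card_imset _ (@enum_rank_inj G)); apply: eq_card => i.
rewrite inE; apply/idP/imsetP => [Wi | [x Wx ->]]; last by rewrite enum_rankK.
by exists (enum_val i); rewrite ?enum_valK.
Qed.

Section Embedding.
Variables (K : fieldType) (G1 G2 : sgraph) (phi : G1 -> G2) (W : {set G1}).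
Hypotheses (phi_inj : injective phi) (phi_adj : forall x y, adj (phi x) (phi y) = adj x y).
Implicit Types (x y : G1) (m : 'X_{1..#|G1|}) (a : 'X_{1..#|G2|}).
Local Notation phiW := (phi @: W).

Definition push m : 'X_{1..#|G2|} :=
  (\sum_(x in W) U_(enum_rank (phi x)) *+ m (enum_rank x))%MM.

Definition pull a : 'X_{1..#|G1|} :=
  [multinom if enum_val i \in W then a (enum_rank (phi (enum_val i))) else 0%N | i < #|G1|].

Lemma pullE a x : pull a (enum_rank x) = if x \in W then a (enum_rank (phi x)) else 0%N.
Proof. by rewrite mnmE enum_rankK. Qed.

Lemma push_in m x : x \in W -> push m (enum_rank (phi x)) = m (enum_rank x).
Proof.
move=> Wx; rewrite mnm_sumE (bigD1 x) //= mulmnE mnm1E eqxx mul1n big1 ?addn0 //.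
move=> y /andP [_ neq_yx]; rewrite mulmnE mnm1E (inj_eq enum_rank_inj) (inj_eq phi_inj).
by rewrite (negPf neq_yx).
Qed.

Lemma push_out m (z : G2) : z \notin phiW -> push m (enum_rank z) = 0%N.
Proof.
move=> nWz; rewrite mnm_sumE big1 // => x Wx; rewrite mulmnE mnm1E (inj_eq enum_rank_inj).
by case: eqP => // def_z; rewrite -def_z imset_f in nWz.
Qed.

Lemma push_rst m : rst (var_set phiW) (push m) = push m.
Proof. by apply/rst_idP => i; rewrite inE => /(push_out m); rewrite enum_valK. Qed.

Lemma push_pull a : rst (var_set phiW) a = a -> push (pull a) = a.
Proof.
move=> /rst_idP aW; apply/mnmP => i; rewrite -(enum_valK i); move: (enum_val i) => z.
have [/imsetP [x Wx ->] | nWz] := boolP (z \in phiW); first by rewrite push_in // pullE Wx.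
by rewrite push_out // aW // mem_var_set.
Qed.

Lemma pull_push m : ~~ touches (~: W) m -> pull (push m) = m.
Proof.
move=> nWm; apply/mnmP => i; rewrite -(enum_valK i); move: (enum_val i) => x.
rewrite pullE; case: ifPn => [Wx | nWx]; first exact: push_in.
apply/esym/eqP; apply: contraR nWm => mx; apply/touchesP.
by exists x; rewrite ?inE.
Qed.

Lemma touches_pull a : touches (~: W) (pull a) = false.
Proof.
by apply/touchesP => -[x]; rewrite inE pullE => /negPf ->.
Qed.

Lemma has_edge_pull a : has_edge W (pull a) = has_edge phiW a.
Proof.
apply/has_edgeP/has_edgeP => [[x [y [Wx Wy xy]]] | [_ [_ [/imsetP [x Wx ->] /imsetP [y Wy ->]]]]].
  rewrite !pullE Wx Wy => ax ay; exists (phi x), (phi y).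
  by rewrite !imset_f ?phi_adj.
by rewrite phi_adj => xy ax ay; exists x, y; rewrite !pullE Wx Wy.
Qed.

Definition rename : #|G1|.-tuple {mpoly K[#|G2|]} :=
  [tuple if enum_val i \in W then 'X_(enum_rank (phi (enum_val i))) else 0 | i < #|G1|].

Lemma renameX m : ('X_[m] : {mpoly K[#|G1|]}) \mPo rename =
  if touches (~: W) m then 0 else 'X_[push m].
Proof.
rewrite comp_mpolyX (reindex _ (onW_bij _ (@enum_rank_bij G1))) /=.
case: ifPn => [/touchesP [x nWx mx] | nWm].
  rewrite (bigD1 x) //= tnth_mktuple enum_rankK; rewrite inE in nWx.
  by rewrite (negPf nWx) expr0n (negPf mx) mul0r.
rewrite /push -mprodXnE [RHS]big_mkcond /=; apply: eq_bigr => x _.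
rewrite tnth_mktuple enum_rankK; case: ifPn => // nWx.
suff -> : m (enum_rank x) = 0%N by rewrite expr0.
by apply/eqP; apply: contraR nWm => mx; apply/touchesP; exists x; rewrite ?inE.
Qed.

(** No cancellation occurs, since [pull] recovers [m] from [push m]. *)
Lemma rename_coef (f : {mpoly K[#|G1|]}) m : ~~ touches (~: W) m ->
  (f \mPo rename)@_(push m) = f@_m.
Proof.
move=> nWm; rewrite comp_mpolyEX raddf_sum /=.
have zero m' : m' != m -> f@_m' * ('X_[m'] \mPo rename)@_(push m) = 0.
  move=> neq_m; rewrite renameX; case: ifPn => [_ | nWm']; first by rewrite mcoeff0 mulr0.
  rewrite mcoeffX; case: eqP => [eq_push | _]; last by rewrite mulr0.
  by rewrite -(pull_push nWm) -eq_push pull_push ?eqxx in neq_m.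
have [fm | nfm] := boolP (m \in msupp f).
  rewrite (bigD1_seq m) ?msupp_uniq //= mcoeffZ renameX (negPf nWm) mcoeffX eqxx mulr1.
  by rewrite big1 ?addr0 // => m' /zero; rewrite mcoeffZ.
rewrite big_seq big1 ?memN_msupp_eq0 // => m' fm'; rewrite mcoeffZ zero //.
by apply: contraNneq nfm => <-.
Qed.

Lemma rename_in (f : {mpoly K[#|G1|]}) : poly_in (var_set phiW) (f \mPo rename).
Proof.
rewrite comp_mpolyEX; apply: poly_in_sum => m _; apply: poly_inZ; rewrite renameX.
by case: ifP => _; [apply: poly_in0 | apply: poly_inX; apply: push_rst].
Qed.

(** When [W] is the set of non-isolated vertices these are the monomials of the edge ideal,
 in which isolated vertices are generators. *)
Definition killed_edges m : bool := has_edge W m || touches (~: W) m.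

Lemma killed_edges_upset : upset killed_edges.
Proof.
by move=> a m /orP [/has_edge_upset | /touches_upset] up; rewrite /killed_edges up ?orbT.
Qed.

Lemma killed_edges_pull a : killed_edges (pull a) = has_edge phiW a.
Proof. by rewrite /killed_edges touches_pull orbF has_edge_pull. Qed.

Lemma rename_mid (f : {mpoly K[#|G1|]}) :
  mid killed_edges f <-> mid (has_edge phiW) (f \mPo rename).
Proof.
have idJ := mid_ideal K (@has_edge_upset _ phiW); split=> [fC | Jf m fm].
  rewrite comp_mpolyEX big_seq; apply: (ideal_sum idJ) => m /fC Cm.
  rewrite -mul_mpolyC; apply: (ideal_Ml idJ); rewrite renameX.
  case: ifPn => [_ | nWm]; first exact: ideal_0.
  by apply/midX; rewrite -has_edge_pull pull_push //; rewrite /killed_edges (negPf nWm) orbF in Cm.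
rewrite /killed_edges; have [_ | nWm] := boolP (touches _ _); first by rewrite orbT.
rewrite orbF -(pull_push nWm) has_edge_pull; apply: Jf.
by rewrite mcoeff_msupp rename_coef // -mcoeff_msupp.
Qed.

Lemma graph_depth_embed d :
  has_depth (aug setT) (mid (K := K) killed_edges) d -> graph_depth K phiW d.
Proof.
have surj (F : {mpoly K[#|G2|]}) : poly_in (var_set phiW) F ->
    exists f : {mpoly K[#|G1|]}, F = f \mPo rename.
  move=> /poly_inP FA; exists (\sum_(a <- msupp F) F@_a *: 'X_[pull a]).
  rewrite raddf_sum /= [LHS]mpolyE !big_seq; apply: eq_bigr => a /FA aA.
  by rewrite comp_mpolyZ renameX touches_pull push_pull.
have coef0 (f : {mpoly K[#|G1|]}) : (f \mPo rename)@_0%MM = f@_0%MM.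
  have push0 : push 0%MM = 0%MM.
    by rewrite /push big1 // => x _; rewrite mnm0E mulm0n.
  rewrite -{1}push0 rename_coef //.
  by apply/touchesP => -[x _]; rewrite mnm0E.
apply: (has_depth_transport (psi := comp_mpoly rename)).
- exact: edges_generated_in.
- exact: rename_in.
- exact: surj.
- exact: rename_mid.
- by move=> f [_ f0]; split; [apply: rename_in | rewrite coef0].
- move=> F [/surj [f ->] f0]; exists f => //; split; first exact: poly_inT.
  by rewrite -coef0.
Qed.

Lemma graph_sdepth_embed d : sdepth_ge setT killed_edges d -> graph_sdepth phiW d.
Proof.
move=> [l [_ lC] ld].
have rstT m : rst setT m = m by apply/rst_idP => i; rewrite inE.
have lfree c m : c \in l -> in_cone m c -> ~~ touches (~: W) m.
  move=> lc cm; have: has (in_cone m) l by apply/hasP; exists c.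
  by rewrite has_count lC // /killed_edges; case: touches; rewrite // orbT.
have l1 c : c \in l -> ~~ touches (~: W) c.1.
  by move=> lc; apply: (lfree c) => //; apply/in_coneP => i; case: ifP.
have l2 c x : c \in l -> enum_rank x \in c.2 -> x \in W.
  move=> lc Xx; have cx : in_cone (U_(enum_rank x) + c.1)%MM c.
    apply/in_coneP => i; rewrite mnmDE leq_addl mnm1E; case: ifPn => // nXi.
    by case: (eqVneq (enum_rank x) i) nXi => [<- | //]; rewrite Xx.
  apply: contraR (lfree c _ lc cx) => nWx; apply/touchesP.
  by exists x; rewrite ?inE // mnmDE mnm1E eqxx.
pose img (c : cone #|G1|) : cone #|G2| :=
  (push c.1, var_set (phi @: [set x | enum_rank x \in c.2])).
exists (map img l); first split.
- move=> c /mapP [c' lc ->] /=; rewrite push_rst; split=> //.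
  apply/subsetP => i; rewrite !inE => /imsetP [x]; rewrite inE => Xx ->.
  by rewrite imset_f // (l2 c').
- move=> a aA; rewrite count_map -killed_edges_pull -lC //; apply: eq_in_count => c lc /=.
  have c1W x : x \notin W -> c.1 (enum_rank x) = 0%N.
    move=> nWx; apply/eqP; apply: contraR (l1 c lc) => cx; apply/touchesP.
    by exists x; rewrite ?inE.
  have imgE x : (enum_rank (phi x) \in (img c).2) = (enum_rank x \in c.2).
    by rewrite mem_var_set (mem_imset _ _ phi_inj) inE.
  apply/in_coneP/in_coneP => ca i; rewrite -(enum_valK i); move: (enum_val i) => x.
    have := ca (enum_rank (phi x)); rewrite imgE /= pullE.
    have [Wx | nWx] := boolP (x \in W); first by rewrite push_in.
    by rewrite c1W // (contraNF (l2 c x lc) nWx).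
  have [/imsetP [y Wy ->] | nWx] := boolP (x \in phiW).
    by have := ca (enum_rank y); rewrite imgE /= pullE Wy push_in.
  have nXx : enum_rank x \notin (img c).2.
    rewrite mem_var_set; apply: contra nWx => /imsetP [y]; rewrite inE => Xy ->.
    by rewrite imset_f // (l2 c).
  by move/rst_idP: aA => aA; rewrite (negPf nXx) aA ?mem_var_set //= push_out.
move=> c /mapP [c' lc ->] /=; rewrite card_var_set card_imset //.
rewrite (leq_trans (ld c' lc)) // -(card_imset _ (@enum_val_inj _ _)).
apply/subset_leq_card/subsetP => x /imsetP [i Xi ->].
by rewrite inE enum_valK.
Qed.

End Embedding.

(** * Depth and Stanley depth as maxima *)

Lemma nat_max_spec (P : nat -> Prop) (N : nat) :
  (exists k, P k) -> (forall k, P k -> (k <= N)%N) ->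
  P (nat_max P) /\ forall k, P k -> (k <= nat_max P)%N.
Proof.
move=> exP leN; suff [d maxd] : exists d, is_nat_max P d by rewrite (nat_max_eq maxd).
elim: N leN => [|N IHN] leN; last first.
  have [PN | nPN] := classic (P N.+1); first by exists N.+1.
  apply: IHN => k Pk; have := leN k Pk; rewrite leq_eqVlt => /predU1P [eq_k | //].
  by case: nPN; rewrite -eq_k.
by case: exP => k Pk; exists k; split=> // l /leN; rewrite leqn0 => /eqP ->.
Qed.

Section IdealGen.
Variable R : comNzRingType.
Implicit Types (gens J : R -> Prop) (f g : R) (s : seq R).

Lemma ideal_gen_min gens J : ideal J -> (forall f, gens f -> J f) ->
  forall f, ideal_gen gens f -> J f.
Proof.
move=> idJ gJ f [k [c [g [gensg ->]]]]; apply: (ideal_sum idJ) => i _.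
by apply: (ideal_Ml idJ); apply: gJ.
Qed.

Lemma mem_ideal_gen gens f : gens f -> ideal_gen gens f.
Proof.
by move=> gf; exists 1%N, (fun=> 1), (fun=> f); split=> //; rewrite big_ord1 mul1r.
Qed.

Lemma ideal_gen_ideal gens : ideal (ideal_gen gens).
Proof.
split.
- by exists 0%N, (fun=> 0), (fun=> 0); split=> [[]|]; rewrite ?big_ord0.
- move=> _ _ [k1 [c1 [g1 [gens1 ->]]]] [k2 [c2 [g2 [gens2 ->]]]].
  exists (k1 + k2)%N, (fun i => match split i with inl j => c1 j | inr j => c2 j end).
  exists (fun i => match split i with inl j => g1 j | inr j => g2 j end).
  split=> [i|]; first by case: split.
  rewrite big_split_ord; congr (_ + _); apply: eq_bigr => i _.
    by rewrite (unsplitK (inl i)).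
  by rewrite (unsplitK (inr i)).
move=> b _ [k [c [g [gensg ->]]]]; exists k, (fun i => b * c i), g; split=> //.
by rewrite mulr_sumr; apply: eq_bigr => i _; rewrite mulrA.
Qed.

Lemma adds_sub J L s : ideal L -> (forall f, J f -> L f) -> (forall f, f \in s -> L f) ->
  forall f, adds J s f -> L f.
Proof.
move=> idL; elim: s J => //= g s IHs J JL sL; apply: IHs => [|f sf].
  by apply: addI_sub => //; apply: sL; rewrite mem_head.
by apply: sL; rewrite in_cons sf orbT.
Qed.

Lemma sub_adds J s f : J f -> adds J s f.
Proof. by elim: s J => //= g s IHs J Jf; apply: IHs; apply: sub_addI. Qed.

Lemma mem_adds J s f : ideal J -> f \in s -> adds J s f.
Proof.
elim: s J => //= g s IHs J idJ; rewrite in_cons => /predU1P [-> | sf].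
  by apply: sub_adds; apply: mem_addI.
by apply: IHs => //; apply: addI_ideal.
Qed.

Lemma regseq_nth J s : regseq J s <->
  forall i, (i < size s)%N -> regular (adds J (take i s)) s`_i.
Proof.
elim: s J => [|f s IHs] J /=; first by split.
split=> [[regf /IHs regs] [|i] // | regs]; first exact: regs.
split; first exact: (regs 0%N).
by apply/IHs => i; apply: (regs i.+1).
Qed.

End IdealGen.

Section Depth.
Variables (K : fieldType) (n : nat).
Local Notation S := {mpoly K[n]}.
Implicit Types (I : S -> Prop) (f e : S) (s : seq S).

Lemma ideal_addE I s : ideal I -> ideal_add I s = adds I s.
Proof.
move=> idI; apply: pred_ext => f; split.
  apply: ideal_gen_min; first exact: adds_ideal.
  by move=> g [/sub_adds | /(mem_adds idI)].
apply: adds_sub; first exact: ideal_gen_ideal.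
  by move=> g Ig; apply: mem_ideal_gen; left.
by move=> g sg; apply: mem_ideal_gen; right.
Qed.

Lemma max_idealE f : max_ideal f <-> aug setT f.
Proof.
have idM : ideal (fun g : S => g@_0%MM = 0).
  split=> [|g h g0 h0|c g g0]; first exact: mcoeff0.
    by rewrite mcoeffD g0 h0 addr0.
  by rewrite mcoeff0M g0 mulr0.
split=> [Mf | f0].
  split; first exact: poly_inT.
  apply: (ideal_gen_min idM) Mf => _ [i ->].
  by rewrite mcoeffX mnm1_eq0.
rewrite -[f]mulr1; apply: aug_kill f0 => [|i _]; first exact: ideal_gen_ideal.
by rewrite mulr1; apply: mem_ideal_gen; exists i.
Qed.

Lemma depth_eq I d : ideal I -> has_depth (aug setT) I d -> depth I = d.
Proof.
move=> idI Id; apply: nat_max_eq; split.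
  case: Id => s [sM regs szs [u Iu Mu]]; exists s; split=> //; split.
  - by move=> f /sM /max_idealE.
  - by move=> i lt_i g; rewrite ideal_addE //; move/regseq_nth: regs; apply.
  - rewrite ideal_addE // => I1; apply: Iu; rewrite -(mulr1 u).
    by apply: ideal_Ml I1; apply: adds_ideal.
move=> k [s [[sM regs _] szs]].
apply: (has_depth_max (@mpoly_noetherian K n) (@subrng_aug K n _) idI Id).
exists s; split=> //; first by move=> f /sM /max_idealE.
by apply/regseq_nth => i lt_i g; have := regs i lt_i g; rewrite ideal_addE.
Qed.

Lemma mid_has_depth C : upset C -> ~~ C 0%MM ->
  exists d, has_depth (aug setT) (mid (K := K) (n := n) C) d.
Proof.
move=> upC C0.
apply: (has_depth_exists (@mpoly_noetherian K n) (@subrng_aug K n _) (L := @max_ideal K n)).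
- exact: mid_ideal.
- exact: ideal_gen_ideal.
- by move/max_idealE => [_ /eqP]; rewrite mcoeff1 eqxx oner_eq0.
- move=> f fC; apply/max_idealE; split; first exact: poly_inT.
  by apply: memN_msupp_eq0; apply: contra C0 => /fC.
- by move=> e /max_idealE.
Qed.

End Depth.

Section StanleyDepth.
Variables (K : fieldType) (n : nat) (C : pred 'X_{1..n}).
Hypothesis (upC : upset C).
Local Notation S := {mpoly K[n]}.
Local Notation I := (mid (K := K) C).
Implicit Types (m a b : 'X_{1..n}) (X : {set 'I_n}) (f p : S) (c : cone n) (l : seq (cone n)).

Lemma in_cone_sub m c : in_cone m c -> (c.1 <= m)%MM /\ rst c.2 (m - c.1) = (m - c.1)%MM.
Proof.
move=> /in_coneP cm; split.
  by apply/mnm_lepP => i; have := cm i; case: ifP => // _ /eqP ->.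
apply/rst_idP => i nXi; have := cm i; rewrite (negPf nXi) mnmBE => /eqP ->.
exact: subnn.
Qed.

Lemma in_cone_add c a : rst c.2 a = a -> in_cone (c.1 + a)%MM c.
Proof.
move=> /rst_idP aX; apply/in_coneP => i; rewrite mnmDE; case: ifPn => [_ | /aX ->].
  exact: leq_addr.
by rewrite addn0.
Qed.

Lemma msupp_cone c p m : poly_in c.2 p -> m \in msupp ('X_[c.1] * p) -> in_cone m c.
Proof.
move=> /poly_inP pX; rewrite mulrC (perm_mem (msuppMX _ _)) => /mapP [b /pX bX ->].
exact: in_cone_add.
Qed.

Lemma count_nth l m i j : (i < size l)%N -> (j < size l)%N -> i != j ->
  in_cone m (nth (0%MM, set0) l i) -> in_cone m (nth (0%MM, set0) l j) ->
  (1 < count (in_cone m) l)%N.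
Proof.
move=> lti ltj neq_ij ci cj; rewrite -sum1_count (big_nth (0%MM, set0)) big_mkord.
rewrite (bigD1 (Ordinal lti)) //= (bigD1 (Ordinal ltj)) //= ?addnA ?leq_addr //.
by rewrite cj -val_eqE /= eq_sym.
Qed.

(** Grouping the monomials of a polynomial by the cone that contains them. *)
Lemma cone_partition_decomposition l : cone_partition setT C l ->
  stanley_decomposition I (fun i : 'I_(size l) => 'X_[(nth (0%MM, set0) l i).1])
    (fun i => (nth (0%MM, set0) l i).2).
Proof.
move=> [_ lC]; pose c (i : 'I_(size l)) := nth (0%MM, set0) l i.
have {}lC m : count (in_cone m) l = ~~ C m.
  by apply: lC; apply/rst_idP => i; rewrite inE.
have cC i m : in_cone m (c i) -> ~~ C m.
  move=> ci; have: has (in_cone m) l by apply/hasP; exists (c i); rewrite ?mem_nth.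
  by rewrite has_count lC; case: (C m).
split.
- by move=> i; exists 1, (c i).1; rewrite scale1r.
- move=> i p pX Ip; apply: msuppnil0; case def_p: (msupp p) => [//|m s].
  have pm : m \in msupp p by rewrite def_p mem_head.
  have cm : ((c i).1 + m)%MM \in msupp ('X_[(c i).1] * p).
    by rewrite mulrC (perm_mem (msuppMX _ _)); apply: map_f.
  by have := cC i _ (msupp_cone pX cm); rewrite Ip.
- move=> f; pose p i : S := \sum_(m <- msupp f | in_cone m (c i)) f@_m *: 'X_[m - (c i).1].
  exists p; split=> [i | ].
    apply: poly_in_sum => m cm; apply: poly_inZ; apply: poly_inX.
    by case: (in_cone_sub cm).
  have -> : \sum_i 'X_[(c i).1] * p i = \sum_(m <- msupp f) (f@_m *: 'X_[m]) *+ (~~ C m).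
    under eq_bigr => i _ do rewrite mulr_sumr big_mkcond.
    rewrite exchange_big; apply: eq_bigr => m _; rewrite -big_mkcond /=.
    rewrite -lC -iter_addr_0 -big_const_seq (big_nth (0%MM, set0)) big_mkord.
    apply: eq_bigr => i ci; rewrite -scalerAr -mpolyXD addmC submK //.
    by case: (in_cone_sub ci).
  rewrite {1}[f]mpolyE -sumrB; apply: (ideal_sum (mid_ideal K upC)) => m _.
  case Cm: (C m); last by rewrite mulr1n subrr; exact: (ideal_0 (mid_ideal K upC)).
  rewrite mulr0n subr0 -mul_mpolyC; apply: (ideal_Ml (mid_ideal K upC)).
  exact/midX.
move=> p pX Ip i m pm; apply: contraT => nCm; suff /Ip : m \in msupp (\sum_i 'X_[(c i).1] * p i).
  by rewrite (negPf nCm).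
have ci := msupp_cone (pX i) pm; rewrite mcoeff_msupp raddf_sum (bigD1 i) //= big1.
  by rewrite addr0 -mcoeff_msupp.
move=> j neq_ji; apply: memN_msupp_eq0; apply/negP => /(msupp_cone (pX j)) cj.
have neq_ij : i != j :> nat by rewrite eq_sym.
by have := count_nth (ltn_ord i) (ltn_ord j) neq_ij ci cj; rewrite lC nCm.
Qed.

(** A monomial outside [C] occurs in some summand because the summands span, and two cones
 through it would break the directness of the sum. *)
Lemma stanley_cone_partition k (a : 'I_k -> S) (X : 'I_k -> {set 'I_n}) :
  stanley_decomposition I a X ->
  exists m : 'I_k -> 'X_{1..n}, cone_partition setT C [seq (m i, X i) | i <- enum 'I_k].
Proof.
move=> [aX free gen dir].
have [c cP] := choice_fun aX; have [m am] := choice_fun cP.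
have nz_c i : c i != 0.
  apply/eqP => c0; have := free i 1; rewrite mulr1 am c0 scale0r => one0.
  have: 1 = 0 :> S.
    apply: one0; last by move=> q; rewrite msupp0.
    by rewrite -mpolyX0; apply: poly_inX; apply: rst0.
  by move/eqP; rewrite oner_eq0.
have X_free i q : in_cone q (m i, X i) -> ~~ C q.
  move=> cq; apply/negP => Cq; have [le_m qX] := in_cone_sub cq.
  have /(free i) : poly_in (X i) ('X_[q - m i] : S) by apply: poly_inX.
  rewrite am -scalerAl -mpolyXD addmC submK // => /(_ _) X0.
  have: 'X_[q - m i] = 0 :> S.
    by apply: X0; rewrite -mul_mpolyC; apply: (ideal_Ml (mid_ideal K upC)); apply/midX.
  by move/eqP; rewrite -msupp_eq0 msuppX.
exists m; split=> [q _ | q _]; first by split; [apply/rst_idP => i; rewrite inE | apply: subsetT].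
rewrite count_map.
have [Cq | nCq] := boolP (C q).
  rewrite (eq_count (a2 := pred0)) ?count_pred0 // => i; apply/negbTE/negP => /= /X_free.
  by rewrite Cq.
have [p [pX Ip]] := gen 'X_[q].
have [i qi]: exists i, q \in msupp (a i * p i).
  apply/existsP; apply: contraT => /existsPn noq.
  have: ('X_[q] - \sum_i a i * p i)@_q = 0.
    by apply: memN_msupp_eq0; apply: contra nCq => /Ip.
  rewrite mcoeffB mcoeffX eqxx raddf_sum big1 => [|j _]; last exact: memN_msupp_eq0.
  by move/eqP; rewrite subr0 oner_eq0.
have qc : in_cone q (m i, X i).
  apply: (msupp_cone (c := (m i, X i)) (pX i)); move: qi.
  by rewrite am -scalerAl => /msuppZ_le.
rewrite (eq_count (a2 := pred1 i)) => [|j /=].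
  by rewrite count_uniq_mem ?enum_uniq // mem_enum.
apply/idP/eqP => [qj | -> //]; apply/eqP; apply: contraT => neq_ji.
have [[le_i iX] [le_j jX]] := (in_cone_sub qc, in_cone_sub qj).
pose p' r := if r == i then (c i)^-1 *: 'X_[q - m i] else
  if r == j then - (c j)^-1 *: 'X_[q - m j] else 0 : S.
have p'X r : poly_in (X r) (p' r).
  rewrite /p'; case: eqP => [-> | _]; first by apply: poly_inZ; apply: poly_inX.
  by case: eqP => [-> | _]; [apply: poly_inZ; apply: poly_inX | apply: poly_in0].
have a_i : a i * p' i = 'X_[q].
  rewrite /p' eqxx am -scalerAl -scalerAr scalerA mulfV // scale1r -mpolyXD.
  by rewrite addmC submK.
have a_j : a j * p' j = - 'X_[q].
  rewrite /p' eqxx (negPf neq_ji) am -scalerAl -scalerAr scalerA mulrN mulfV //.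
  by rewrite scaleN1r -mpolyXD addmC submK.
have: I (a i * p' i).
  apply: dir => //; rewrite (bigD1 i) //= (bigD1 j) //= a_i a_j big1 ?addr0.
    by rewrite subrr; exact: (ideal_0 (mid_ideal K upC)).
  by move=> r /andP [/negPf neq_ri /negPf neq_rj]; rewrite /p' neq_ri neq_rj mulr0.
by rewrite a_i => /midX; rewrite (negPf nCq).
Qed.

Lemma bigmin_geP k (F : 'I_k -> nat) d :
  (d <= \big[minn/n]_(i < k) F i)%N <-> (d <= n)%N /\ forall i, (d <= F i)%N.
Proof.
elim: k F => [|k IHk] F; first by rewrite big_ord0; split=> [-> | []//]; split=> // -[].
rewrite big_ord_recl leq_min; split.
  case/andP => dF0 /IHk [le_dn dF]; split=> // i.
  by case: (unliftP ord0 i) => [j -> | ->].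
by case=> le_dn dF; rewrite dF /=; apply/IHk.
Qed.

Lemma sdepth_spec : ~~ C 0%MM -> sdepth_ge setT C 0 ->
  sdepth_ge setT C (sdepth I) /\ forall d, sdepth_ge setT C d -> (d <= sdepth I)%N.
Proof.
move=> nC0 C_ge0.
pose P r := exists (k : nat) (a : 'I_k -> S) (X : 'I_k -> {set 'I_n}),
  stanley_decomposition I a X /\ \big[minn/n]_(i < k) #|X i| = r.
have P_ge d : sdepth_ge setT C d -> (d <= n)%N -> exists2 r, P r & (d <= r)%N.
  move=> [l lC ld] le_dn; eexists.
    by do 3 eexists; split; [exact: cone_partition_decomposition lC |].
  by apply/bigmin_geP; split=> // i; apply: ld; apply: mem_nth.
have P_le r : P r -> (r <= n)%N.
  case=> k [a [X [_ <-]]].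
  by case: (bigmin_geP (fun i => #|X i|) (\big[minn/n]_i #|X i|)) => /(_ (leqnn _)) [].
have [r0 Pr0 _] := P_ge 0%N C_ge0 isT.
have [Ps s_max] := nat_max_spec (ex_intro _ r0 Pr0) P_le; split.
  case: Ps => k [a [X [dec min_s]]]; have [m mC] := stanley_cone_partition dec.
  exists [seq (m i, X i) | i <- enum 'I_k] => // c /mapP [i _ ->] /=.
  have [+ _] := bigmin_geP (fun i => #|X i|) (sdepth I).
  by rewrite min_s => /(_ (leqnn _)) [_ /(_ i)].
move=> d C_ge.
suff le_dn : (d <= n)%N by have [r /s_max le_rs le_dr] := P_ge d C_ge le_dn; apply: leq_trans le_rs.
case: C_ge => l [_ lC] ld; have: has (in_cone 0%MM) l by rewrite has_count lC ?rst0 // nC0.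
case/hasP => c /ld le_dc _; apply: leq_trans le_dc _.
by rewrite -[X in (_ <= X)%N]card_ord max_card.
Qed.

End StanleyDepth.

(** * Edge ideals *)

Section EdgeIdeals.
Variables (K : fieldType) (G : sgraph).
Local Notation S := {mpoly K[#|G|]}.
Local Notation W := (~: isolated G).
Implicit Types (x y : G) (m : 'X_{1..#|G|}).

Lemma isolatedP x : reflect (forall y, ~~ adj x y) (x \in isolated G).
Proof. by rewrite inE; apply: forallP. Qed.

Lemma adj_not_isolated x y : adj x y -> x \in W.
Proof. by move=> xy; rewrite in_setC; apply/isolatedP => /(_ y); rewrite xy. Qed.

Lemma edge_idealE : edge_ideal K G = mid (killed_edges W).
Proof.
have upC := @killed_edges_upset G W; have idC := mid_ideal K upC.
apply: pred_ext => F; split.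
  apply: ideal_gen_min => // _ [[x [y [xy ->]]] | [x [iso_x ->]]].
    rewrite /vertex_var -mpolyXD; apply/midX/orP; left; apply/has_edgeP; exists x, y.
    split=> //; first exact: adj_not_isolated xy.
    - by apply: (@adj_not_isolated y x); rewrite adj_sym.
    - by rewrite mnmDE mnm1E eqxx.
    by rewrite mnmDE addnC mnm1E eqxx.
  apply/midX/orP; right; apply/touchesP; exists x; first by rewrite setCK.
  by rewrite mnm1E eqxx.
have idE : ideal (edge_ideal K G) by apply: ideal_gen_ideal.
apply: (mid_ind idE) => m /orP [/has_edgeP [x [y [_ _ xy mx my]]] | /touchesP [x iso_x mx]].
  have neq_xy : x != y by apply: contraTneq xy => ->; rewrite adj_irr.
  have le_m : (U_(enum_rank x) + U_(enum_rank y) <= m)%MM.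
    apply/mnm_lepP => i; rewrite mnmDE !mnm1E.
    case: eqP => [<- | _]; last by case: eqP => [<- | //]; rewrite add0n lt0n.
    by rewrite (inj_eq enum_rank_inj) eq_sym (negPf neq_xy) lt0n.
  rewrite -(submK le_m) mpolyXD; apply: (ideal_Ml idE); apply: mem_ideal_gen.
  by left; exists x, y; rewrite mpolyXD.
rewrite -(submK (m := U_(enum_rank x)%MM) (m' := m)) ?lep1mP // mpolyXD.
apply: (ideal_Ml idE); apply: mem_ideal_gen; right; exists x.
by rewrite setCK in iso_x.
Qed.

Lemma killed_edges0 : ~~ killed_edges W 0%MM.
Proof.
apply/norP; split; first by apply/has_edgeP => -[x [y [_ _ _]]]; rewrite mnm0E.
by apply/touchesP => -[x _]; rewrite mnm0E.
Qed.

Lemma edge_depth : has_depth (aug setT) (mid (K := K) (killed_edges W)) (depth (edge_ideal K G)).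
Proof.
have upC := @killed_edges_upset G W.
have [d Gd] := mid_has_depth K upC killed_edges0.
by rewrite edge_idealE (depth_eq (mid_ideal K upC) Gd).
Qed.

Lemma killed_sdepth_ge0 : sdepth_ge setT (killed_edges W) 0.
Proof.
have tW : sdepth_ge (var_set (~: W)) (touches (~: W)) 0.
  exists [:: (0%MM, set0)] => //; split=> [c | m mW].
    by rewrite mem_seq1 => /eqP -> /=; rewrite rst0 sub0set.
  rewrite /= addn0; congr nat_of_bool; apply/in_coneP/negP => [m0 /touchesP [x _] | nW i].
    by have := m0 (enum_rank x); rewrite inE mnm0E => ->.
  rewrite inE mnm0E; apply: contraT => mi; case: nW; apply/touchesP.
  exists (enum_val i).
    apply: contraR mi => nWi; apply/eqP; move/rst_idP: mW; apply.
    by rewrite inE.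
  by rewrite enum_valK.
have W0 : graph_sdepth W 0.
  have [-> | nzW] := eqVneq W set0; first exact: graph_sdepth0.
  exact: sdepth_ge_le (graph_sdepth_gt0 nzW) _.
have disW : [disjoint var_set W & var_set (~: W)].
  by apply: var_set_disjoint; rewrite -setI_eq0 setICr.
have -> : setT = var_set W :|: var_set (~: W).
  by rewrite -var_setU setUCr; apply/setP => i; rewrite !inE.
exact: sdepth_ge_tensor disW (@has_edge_rst _ _) (@touches_rst _ _) W0 tW.
Qed.

Lemma edge_sdepth : sdepth_ge setT (killed_edges W) (sdepth (edge_ideal K G)).
Proof.
rewrite edge_idealE.
by have [] := sdepth_spec K (@killed_edges_upset G W) killed_edges0 killed_sdepth_ge0.
Qed.

(** In depth [0] the socle would contain a monomial [m] outside the squarefree ideal;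
 multiplying [m] by one of its own variables, or by any vertex when [m = 1], cannot
 bring it into the ideal. *)
Lemma edge_depth_gt0 : (0 < #|G|)%N -> isolated G = set0 -> (0 < depth (edge_ideal K G))%N.
Proof.
move=> G_gt0 iso0; rewrite lt0n; apply/eqP => d0; have := edge_depth; rewrite d0.
case=> s [_ _ /size0nil -> [u /= nCu Mu]].
have [m um nCm]: exists2 m, m \in msupp u & ~~ killed_edges W m.
  apply: NNPP => no_m; apply: nCu => m um; apply: contraT => nCm.
  by case: no_m; exists m.
have kE m' : killed_edges W m' = has_edge W m'.
  rewrite /killed_edges iso0 setC0 [touches _ _](_ : _ = false) ?orbF //.
  by apply/touchesP => -[x]; rewrite !inE.
have [x mx]: exists x, m != 0%MM -> m (enum_rank x) != 0%N.
  have [-> | nz_m] := eqVneq m 0%MM; first by have [x _] := card_gt0P G_gt0; exists x.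
  have [i mi]: exists i, m i != 0%N.
    apply/existsP; apply: contraR nz_m => /existsPn m0; apply/eqP/mnmP => i.
    by rewrite mnm0E; apply/eqP; rewrite -[_ == _]negbK.
  by exists (enum_val i); rewrite enum_valK.
have: killed_edges W (U_(enum_rank x) + m)%MM.
  apply: (Mu 'X_(enum_rank x)); first by apply: augX; rewrite inE.
  by rewrite mulrC (perm_mem (msuppMX _ _)); apply: map_f.
rewrite kE; apply/negP; apply: contra nCm; rewrite kE.
case/has_edgeP => y [z [Wy Wz yz]]; rewrite !mnmDE !mnm1E !(inj_eq enum_rank_inj).
have neq_yz : y != z by apply: contraTneq yz => ->; rewrite adj_irr.
have [m0 | nz_m] := eqVneq m 0%MM.
  rewrite m0 !mnm0E !addn0 !eqb0 !negbK => /eqP eq_y /eqP eq_z.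
  by rewrite -eq_y -eq_z eqxx in neq_yz.
have {}mx := mx nz_m.
have keep v : ((x == v) + m (enum_rank v))%N != 0%N -> m (enum_rank v) != 0%N.
  by case: (eqVneq x v) => [<- _ // | _]; rewrite add0n.
by move=> /keep my /keep mz; apply/has_edgeP; exists y, z.
Qed.

Lemma edge_sdepth_gt0 : (0 < #|G|)%N -> isolated G = set0 -> (0 < sdepth (edge_ideal K G))%N.
Proof.
move=> G_gt0 iso0.
have [_] := sdepth_spec K (@killed_edges_upset G W) killed_edges0 killed_sdepth_ge0.
rewrite -edge_idealE; apply; rewrite iso0 setC0.
have -> : setT = var_set [set: G] by apply/setP => i; rewrite !inE.
apply: (eq_sdepth_ge (C1 := has_edge setT)) => [m | ].
  rewrite /killed_edges [touches _ _](_ : _ = false) ?orbF //.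
  by apply/touchesP => -[x]; rewrite !inE.
by apply: graph_sdepth_gt0; rewrite -card_gt0 cardsT.
Qed.

End EdgeIdeals.

Lemma graph_depth_rules (K : fieldType) (G : sgraph) : depth_rules (@graph_depth K G).
Proof.
split; [exact: graph_depth0 | exact: graph_depth1 | exact: graph_depth_disjoint |].
exact: graph_depth_vertex.
Qed.

Lemma graph_sdepth_rules (G : sgraph) : depth_rules (@graph_sdepth G).
Proof.
split; [exact: graph_sdepth0 | exact: graph_sdepth1 | exact: graph_sdepth_disjoint |].
exact: graph_sdepth_vertex.
Qed.

(** * The corona of a path with a graph *)

Section Main.
Variables (n : nat) (H : sgraph).
Local Notation G := (corona (path_graph n) H).
Hypothesis H_gt0 : (0 < #|H|)%N.
Implicit Types (i : 'I_n) (h : H) (v : G).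

Definition in_copy i h : G := inr (i, h).

Lemma in_copy_inj i : injective (in_copy i).
Proof. by move=> h k []. Qed.

Lemma in_copy_adj i h k : adj (in_copy i h) (in_copy i k) = adj h k.
Proof. by rewrite /= eqxx. Qed.

Lemma copy_rules (D : {set G} -> nat -> Prop) i t : depth_rules D ->
  D (in_copy i @: (~: isolated H)) t -> D (copy H i) (t + #|isolated H|)%N.
Proof.
move=> rulesD Dt; have [_ _ DU _] := rulesD.
have -> : copy H i = in_copy i @: (~: isolated H) :|: in_copy i @: isolated H.
  rewrite -imsetU setUC setUCr; apply/setP => v.
  by apply/imsetP/imsetP => -[h _ ->]; exists h.
have noE : no_edges (in_copy i @: [set: H]) (in_copy i @: isolated H).
  move=> _ _ /imsetP [h _ ->] /imsetP [k /isolatedP iso_k ->].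
  by rewrite in_copy_adj adj_sym.
apply: DU => //.
- rewrite -setI_eq0 -imsetI; last by move=> h k _ _; apply: in_copy_inj.
  by rewrite setIC setICr imset0.
- by move=> x y /imsetP [h _ ->] yiso; apply: noE; rewrite ?imset_f.
rewrite -(card_imset _ (@in_copy_inj i)); apply: depth_rules_discrete => //.
by move=> x y /imsetP [h _ ->] yiso; apply: noE; rewrite ?imset_f.
Qed.

Lemma corona_not_isolated : isolated G = set0.
Proof.
have [h0 _] := card_gt0P H_gt0.
apply/setP => v; rewrite in_set0; apply/negbTE/isolatedP.
case: v => [i | [i h]] noadj.
  by have := noadj (inr (i, h0)); rewrite /= eqxx.
by have := noadj (inl i); rewrite /= eqxx.
Qed.

Lemma killed_edges_setT m : killed_edges (~: isolated G) m = has_edge [set: G] m.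
Proof.
rewrite /killed_edges corona_not_isolated setC0 [touches _ _](_ : _ = false) ?orbF //.
by apply/touchesP => -[x]; rewrite !inE.
Qed.

Lemma initial_full : initial n H n = [set: G].
Proof. by apply/setP => -[i | [i h]]; rewrite !inE /= ltn_ord. Qed.

Lemma var_setT : var_set [set: G] = setT.
Proof. by apply/setP => i; rewrite !inE. Qed.

Lemma corona_rule (D : {set G} -> nat -> Prop) t : depth_rules D ->
  (forall i, D (in_copy i @: (~: isolated H)) t) -> (0 < t + #|isolated H|)%N ->
  D [set: G] (path_depth (t + #|isolated H|) n).
Proof.
move=> rulesD Dt t_gt0; rewrite -initial_full.
by apply: initial_depth => // i; apply: copy_rules.
Qed.

Lemma corona_depth (K : fieldType) :
  depth (edge_ideal K G) = path_depth (depth (edge_ideal K H) + #|isolated H|) n.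
Proof.
have t_gt0 : (0 < depth (edge_ideal K H) + #|isolated H|)%N.
  rewrite addn_gt0 card_gt0; case: eqVneq => [iso0 | _]; last by rewrite orbT.
  by rewrite edge_depth_gt0.
have GD := corona_rule (graph_depth_rules K G)
  (fun i => graph_depth_embed (@in_copy_inj i) (@in_copy_adj i) (edge_depth K H)) t_gt0.
rewrite edge_idealE (eq_mid K killed_edges_setT).
by apply: depth_eq; [apply/mid_ideal/has_edge_upset | rewrite -var_setT].
Qed.

Lemma corona_sdepth (K : fieldType) :
  (path_depth (sdepth (edge_ideal K H) + #|isolated H|) n <= sdepth (edge_ideal K G))%N.
Proof.
have t_gt0 : (0 < sdepth (edge_ideal K H) + #|isolated H|)%N.
  rewrite addn_gt0 card_gt0; case: eqVneq => [iso0 | _]; last by rewrite orbT.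
  by rewrite edge_sdepth_gt0.
have GD := corona_rule (graph_sdepth_rules G)
  (fun i => graph_sdepth_embed (@in_copy_inj i) (@in_copy_adj i) (edge_sdepth K H)) t_gt0.
rewrite [edge_ideal K G]edge_idealE.
have [_] := sdepth_spec K (@killed_edges_upset G _) (killed_edges0 G) (killed_sdepth_ge0 G).
apply; apply: eq_sdepth_ge (fun m => esym (killed_edges_setT m)) _.
by rewrite -var_setT.
Qed.

(** For null [H] this is a maximal independent set of the size of the Stanley depth. *)
Definition facet : {set G} :=
  [set v : G | match v with inl i => ~~ odd (i : 'I_n) | inr (i, _) => odd (i : 'I_n) end].

Lemma card_facet : #|facet| = path_depth #|H| n.
Proof.
have up : (\sum_(i < n) ~~ odd i)%N = uphalf n.
  elim: n => [|k IHk]; first by rewrite big_ord0.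
  by rewrite big_ord_recr /= IHk uphalf_half; case: (odd k) => /=; lia.
have half : (\sum_(i < n) odd i)%N = n./2.
  elim: n => [|k IHk]; first by rewrite big_ord0.
  by rewrite big_ord_recr /= IHk uphalf_half addnC.
rewrite /path_depth -up -half -sum1_card big_mkcond big_sumType /=; congr (_ + _)%N.
  by apply: eq_bigr => i _; rewrite inE; case: odd.
rewrite (eq_bigr (fun p : 'I_n * H => (odd p.1 : nat))) => [|[i h] _]; last first.
  by rewrite inE; case: odd.
rewrite -(pair_bigA _ (fun (i : 'I_n) (_ : H) => (odd i : nat))) big_distrl /=.
by apply: eq_bigr => i _; rewrite sum_nat_const mulnC.
Qed.

Lemma null_corona_sdepth_le (K : fieldType) : null_graph H ->
  (sdepth (edge_ideal K G) <= path_depth #|H| n)%N.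
Proof.
move=> nullH; have [h0 _] := card_gt0P H_gt0; rewrite -card_facet -card_var_set.
apply: (sdepth_ge_facet (C := has_edge [set: G])); last first.
  exact: eq_sdepth_ge killed_edges_setT (edge_sdepth K G).
- move=> m i nFi mF mi; rewrite -(enum_valK i) in mi nFi.
  move: (enum_val i) mi nFi => v mv; rewrite mem_var_set inE => nFv.
  have [w vw Fw] : exists2 w, adj v w & w \in facet.
    case: v nFv {mv} => [j | [j h]] /=.
      by rewrite negbK => odd_j; exists (inr (j, h0)); rewrite ?inE /= ?eqxx.
    by move=> ev_j; exists (inl j); rewrite ?inE /= ?eqxx.
  apply/has_edgeP; exists v, w; rewrite !inE; split=> //.
  by apply: mF; rewrite mem_var_set.
move=> m /rst_idP mF; apply/has_edgeP => -[v [w [_ _ vw mv mw]]].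
have inF u : m (enum_rank u) != 0%N -> u \in facet.
  by move=> mu; apply: contraNT mu => nFu; rewrite mF // mem_var_set.
move: (inF _ mv) (inF _ mw) vw; rewrite !inE.
case: v {mv} => [i | [i h]]; case: w {mw} => [j | [j k]] //=.
- rewrite /path_adj => ev_i ev_j /orP [] /eqP ij; [move: ev_j | move: ev_i].
    by rewrite -ij /= negbK (negPf ev_i).
  by rewrite -ij /= negbK (negPf ev_j).
- by move=> ev_i odd_j /eqP ij; rewrite ij odd_j in ev_i.
- by move=> odd_i ev_j /eqP ij; rewrite -ij odd_i in ev_j.
by move=> _ _ /andP [_]; apply/negP.
Qed.

End Main.

Theorem theorem2p5 (K : fieldType) (n : nat) (H : sgraph)
    (n_gt0 : (1 <= n)%N) (H_gt0 : (0 < #|H|)%N) :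
  [/\ depth (edge_ideal K (corona (path_graph n) H)) =
        (uphalf n + uphalf (n - 1) * (depth (edge_ideal K H) + #|isolated H|))%N,
      (sdepth (edge_ideal K (corona (path_graph n) H)) >=
        uphalf n + uphalf (n - 1) * (sdepth (edge_ideal K H) + #|isolated H|))%N
    & null_graph H ->
      sdepth (edge_ideal K (corona (path_graph n) H)) =
        (uphalf n + uphalf (n - 1) * #|H|)%N].
Proof.
have -> : uphalf (n - 1) = n./2 by case: n n_gt0 => // k _; rewrite subn1.
split; [exact: corona_depth | exact: corona_sdepth | move=> nullH].
apply/eqP; rewrite eqn_leq null_corona_sdepth_le //=.
apply: leq_trans (corona_sdepth n H_gt0 K); rewrite /path_depth leq_add2l leq_mul2l.
apply/orP; right; have -> : isolated H = setT.
  by apply/setP => x; rewrite in_setT; apply/isolatedP => y; apply: nullH.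
by rewrite cardsT leq_addl.
Qed.
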